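(* Let $P$ be a probability distribution supported on the sphere $\{x\in\mathbb{R}^n:\|x\|=\sqrt n\}$, and for $\lambda\in\mathbb{R}^n$ let $P_\lambda$ be its tilt, defined by $\frac{dP_\lambda}{dP}(x)\propto e^{\langle\lambda,x\rangle}$. Suppose we are given a sampling oracle for $P$ and all of its tilts $P_\lambda$, and suppose that for every $\lambda$ the covariance matrix of $P_\lambda$ has spectral norm at most $M$. Let $J\in\mathbb{R}^{n\times n}$ be symmetric positive semidefinite and let $Q$ be the reweighted measure $\frac{dQ}{dP}(x)\propto e^{-\langle x,Jx\rangle/2}$. Then for any $\varepsilon>0$ and $\delta\in(0,1)$ there exists an algorithm which, with probability at least $1-\delta$, outputs $\lambda\in\mathbb{R}^n$ such that \[\log\frac{dQ}{dP_\lambda}(x)\le M\operatorname{Tr}(J)+\varepsilon\] (for all $x$ in the support of $P$), with runtime and number of oracle calls polynomial in $n$, $1/\varepsilon$, $M$, $\log(1/\delta)$ and $\|J\|_{\mathrm{op}}$.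
   Context: $\|J\|_{\mathrm{op}}$ is the spectral norm. A sampling oracle for a distribution returns an independent exact sample from it on each call. *)

(* Defs.v *)
From HB Require Import structures.
From mathcomp Require Import all_boot all_order all_algebra.
From mathcomp Require Import all_classical all_reals all_analysis.
From mathcomp Require Import measurable_realfun ring.

Set Implicit Arguments.
Unset Strict Implicit.
Unset Printing Implicit Defensive.

Import Order.TTheory GRing.Theory Num.Theory.
Import numFieldNormedType.Exports.

Local Open Scope classical_set_scope.
Local Open Scope ring_scope.

Section euclidean.
Context {R : realType} {n : nat}.
Implicit Types (x y : 'rV[R]_n) (A : 'M[R]_n).

Definition dot x y : R := \sum_(i < n) x ord0 i * y ord0 i.

Definition enorm x : R := Num.sqrt (dot x x).

(* A x, for vectors written as rows.                                          *)
Definition mulv A x : 'rV[R]_n := x *m A^T.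

Definition quad A x : R := dot x (mulv A x).

Definition opnorm A : R :=
  sup [set enorm (mulv A x) | x in [set x | enorm x <= 1]].

Definition psd A : Prop := A^T = A /\ forall x, 0 <= quad A x.

End euclidean.

(* The Borel sigma-algebra of 'rV[R]_n, generated by the coordinates in the   *)
(* same way as the library's sigma-algebra on n.-tuple T.                     *)
Section rV_borel.
Context {R : realType} (n : nat).

Let coord : 'I_n -> 'rV[R]_n -> R := fun i x => x ord0 i.

Let coord_set0 : g_sigma_preimage coord set0.
Proof. exact: sigma_algebra0. Qed.

Let coord_setC A : g_sigma_preimage coord A -> g_sigma_preimage coord (~` A).
Proof. exact: sigma_algebraC. Qed.

Let coord_bigcup (F : (set 'rV[R]_n)^nat) :
  (forall i, g_sigma_preimage coord (F i)) ->
  g_sigma_preimage coord (\bigcup_i (F i)).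
Proof. exact: sigma_algebra_bigcup. Qed.

HB.instance Definition _ := @isMeasurable.Build default_measure_display
  'rV[R]_n (g_sigma_preimage coord) coord_set0 coord_setC coord_bigcup.

Lemma measurable_coord (i : 'I_n) :
  measurable_fun [set: 'rV[R]_n] (fun x : 'rV[R]_n => x ord0 i).
Proof.
move=> _ Y mY; rewrite setTI; apply: sub_sigma_algebra => /=.
rewrite -bigcup_seq/=; exists i => /=; first by rewrite mem_index_enum.
by exists Y => //; rewrite setTI.
Qed.

Lemma measurable_dot (l : 'rV[R]_n) : measurable_fun [set: 'rV[R]_n] (dot l).
Proof.
apply: measurable_sum => i; apply: measurable_funM => //.
exact: measurable_coord.
Qed.

Lemma measurable_quad (A : 'M[R]_n) : measurable_fun [set: 'rV[R]_n] (quad A).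
Proof.
apply: measurable_sum => i; apply: measurable_funM.
  exact: measurable_coord.
rewrite (_ : (fun x => _) =
    (fun x : 'rV[R]_n => \sum_j x ord0 j * A^T j i)).
  apply: measurable_sum => j; apply: measurable_funM => //.
  exact: measurable_coord.
by apply/funext => x; rewrite /mulv mxE.
Qed.

Definition negquad (J : 'M[R]_n) (x : 'rV[R]_n) : R := - quad J x / 2.

Lemma measurable_negquad (J : 'M[R]_n) :
  measurable_fun [set: 'rV[R]_n] (negquad J).
Proof.
apply: measurable_funM => //.
by apply: measurableT_comp => //; exact: measurable_quad.
Qed.

HB.instance Definition _ (l : 'rV[R]_n) :=
  isMeasurableFun.Build _ _ _ _ (dot l) (measurable_dot l).

HB.instance Definition _ (J : 'M[R]_n) :=
  isMeasurableFun.Build _ _ _ _ (negquad J) (measurable_negquad J).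

End rV_borel.

Section gibbs.
Local Open Scope ereal_scope.
Context d (T : measurableType d) (R : realType).
Variable P : probability T R.
Implicit Types (h g : {mfun T >-> R}) (A : set T).

(* The measure with density expR \o h with respect to P.                      *)
Definition expmeasure h A : \bar R := \int[P]_(x in A) (expR (h x))%:E.

Let mexp h D : measurable_fun D (fun x => (expR (h x))%:E).
Proof.
by apply/measurable_funTS/measurable_EFinP; exact: measurableT_comp.
Qed.

Let exp_ge0 h x : 0 <= (expR (h x))%:E.
Proof. by rewrite lee_fin expR_ge0. Qed.

Let expmeasure0 h : expmeasure h set0 = 0.
Proof. by rewrite /expmeasure integral_set0. Qed.

Let expmeasure_ge0 h A : 0 <= expmeasure h A.
Proof. by apply: integral_ge0 => x _; exact: exp_ge0. Qed.

Let expmeasure_sigma_additive h : semi_sigma_additive (expmeasure h).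
Proof.
move=> F mF tF mUF; rewrite /expmeasure ge0_integral_bigcup//.
by apply: is_cvg_ereal_nneg_natsum_cond => n _ _; exact: expmeasure_ge0.
Qed.

HB.instance Definition _ h := isMeasure.Build _ _ _ (expmeasure h)
  (expmeasure0 h) (@expmeasure_ge0 h) (@expmeasure_sigma_additive h).

(* The probability measure with density proportional to expR \o h with        *)
(* respect to P. The second argument of mnormalize is the value for a         *)
(* non-normalizable density; see bounded_normalizable and gibbsE.             *)
Definition gibbs h : probability T R := mnormalize (expmeasure h) P.

Definition gibbs_pdf h (x : T) : R :=
  (expR (h x) / fine (\int[P]_y (expR (h y))%:E))%R.

(* The density of gibbs g with respect to gibbs h.                            *)
Definition gibbs_ratio g h (x : T) : R := (gibbs_pdf g x / gibbs_pdf h x)%R.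

Definition normalizable h := \int[P]_x (expR (h x))%:E < +oo.

Lemma bounded_normalizable h (c : R) :
  {ae P, forall x, (h x <= c)%R} -> normalizable h.
Proof.
move=> hc; apply: (@le_lt_trans _ _ (\int[P]_x (expR c)%:E)).
  apply: ae_ge0_le_integral => //.
  by apply: filterS hc => x hxc _; rewrite lee_fin ler_expR.
by rewrite integral_cst//= probability_setT mule1 ltry.
Qed.

Import HBNNSimple.

Lemma ge0_integral_expmeasure h A (f : T -> \bar R) :
  measurable A -> measurable_fun A f -> (forall x, A x -> 0 <= f x) ->
  \int[expmeasure h]_(x in A) f x =
  \int[P]_(x in A) (f x * (expR (h x))%:E).
Proof.
move=> mA mf f0; pose f_ := nnsfun_approx mA mf.
transitivity (limn (fun n => \int[expmeasure h]_(x in A) (f_ n x)%:E)).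
  rewrite -monotone_convergence//.
  - apply: eq_integral => x /set_mem Dx; apply/esym/cvg_lim => //.
    exact: cvg_nnsfun_approx.
  - by move=> n; exact/measurable_EFinP/measurable_funTS.
  - by move=> *; rewrite lee_fin.
  - by move=> x _ m n mn; rewrite lee_fin; exact/lefP/nd_nnsfun_approx.
transitivity (limn (fun n => \int[P]_(x in A)
    ((f_ n x)%:E * (expR (h x))%:E))); last first.
  rewrite -monotone_convergence//.
  - apply: eq_integral => x /set_mem Dx; apply/cvg_lim => //.
    by apply: cvgeZr => //; exact: cvg_nnsfun_approx.
  - move=> n; apply: emeasurable_funM => //.
    exact/measurable_EFinP/measurable_funTS.
  - by move=> n x _; rewrite mule_ge0 ?lee_fin.
  - move=> x _ m n mn; rewrite lee_pmul2r ?lte_fin ?expR_gt0// lee_fin.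
    exact/lefP/nd_nnsfun_approx.
congr (limn _); apply/funext => n.
under eq_integral do rewrite fimfunE// -fsumEFin//.
rewrite ge0_integral_fsum//; last 2 first.
- by move=> r; exact/measurable_EFinP/measurableT_comp.
- by move=> r x _; rewrite nnfun_muleindic_ge0.
under [RHS]eq_integral => x _.
  rewrite fimfunE// -fsumEFin// ge0_mule_fsuml; last first.
    by move=> r; rewrite nnfun_muleindic_ge0.
  over.
rewrite ge0_integral_fsum//; last 2 first.
- move=> r; apply: emeasurable_funM => //.
  exact/measurable_EFinP/measurableT_comp.
- by move=> r x _; rewrite mule_ge0 ?nnfun_muleindic_ge0.
apply: eq_fsbigr => r; rewrite inE/= => -[x _ fxr].
have r0 : (0 <= r)%R by rewrite -fxr.
rewrite integralZl_indic_nnsfun// integral_indic//=.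
under [RHS]eq_integral do rewrite EFinM -muleA.
rewrite [RHS]ge0_integralZl ?lee_fin//; last first.
  by apply: emeasurable_funM => //; exact/measurable_EFinP.
congr (_ * _); rewrite /expmeasure setIC.
rewrite [LHS]integral_mkcondr/=; apply: eq_integral => y _.
by rewrite patchE indicE; case: ifPn => _; rewrite ?mul1e ?mul0e.
Qed.

Lemma partition_gt0 h : 0 < \int[P]_x (expR (h x))%:E.
Proof.
rewrite lt0e integral_ge0 ?andbT//.
apply/eqP => H.
have /ae_eq_integral_abs : \int[P]_x `|(expR (h x))%:E| = 0.
  by rewrite -[RHS]H; apply: eq_integral => x _; rewrite gee0_abs.
move=> /(_ measurableT (@mexp h setT))[N [mN N0]].
rewrite (_ : ~` _ = setT); last first.
  apply/seteqP; split => // x _ /= /(_ Logic.I)/eqP.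
  by rewrite eqe gt_eqF ?expR_gt0.
rewrite subTset => NT; have := probability_setT P.
by rewrite -NT [LHS]N0 => /eqP; rewrite eq_sym onee_eq0.
Qed.

Lemma gibbsE h A : normalizable h -> measurable A ->
  gibbs h A = \int[P]_(x in A) (gibbs_pdf h x)%:E.
Proof.
move=> nh mA; rewrite /gibbs /= /mnormalize /=.
rewrite /expmeasure gt_eqF ?partition_gt0//= lt_eqF//=.
rewrite /gibbs_pdf; under [RHS]eq_integral do rewrite EFinM.
by rewrite ge0_integralZr// lee_fin invr_ge0 fine_ge0// ltW// partition_gt0.
Qed.

Lemma ge0_integral_gibbs h A (f : T -> \bar R) : normalizable h ->
  measurable A -> measurable_fun A f -> (forall x, A x -> 0 <= f x) ->
  \int[gibbs h]_(x in A) f x = \int[P]_(x in A) (f x * (gibbs_pdf h x)%:E).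
Proof.
move=> nh mA mf f0.
have Z0 : (0 <= (fine (\int[P]_x (expR (h x))%:E))^-1)%R.
  by rewrite invr_ge0 fine_ge0// ltW// partition_gt0.
pose c : {nonneg R} := NngNum Z0.
rewrite (eq_measure_integral (mscale c (expmeasure h))); last first.
  move=> B mB _; rewrite /gibbs /= /mnormalize/= /mscale/= /expmeasure.
  by rewrite gt_eqF ?partition_gt0//= lt_eqF//= muleC.
rewrite ge0_integral_mscale// ge0_integral_expmeasure//.
rewrite -ge0_integralZl//; last 2 first.
- exact: emeasurable_funM.
- by move=> x Ax; rewrite mule_ge0// f0.
apply: eq_integral => x _; rewrite /gibbs_pdf EFinM/=.
by rewrite muleCA; congr (_ * _); rewrite muleC.
Qed.

(* gibbs_ratio g h is d(gibbs g)/d(gibbs h).                                  *)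
Lemma gibbs_ratioE g h A : normalizable g -> normalizable h -> measurable A ->
  gibbs g A = \int[gibbs h]_(x in A) (gibbs_ratio g h x)%:E.
Proof.
move=> ng nh mA.
have pdf_gt0 k x : normalizable k -> (0 < gibbs_pdf k x)%R.
  by move=> nk; rewrite divr_gt0 ?expR_gt0// fine_gt0// partition_gt0.
rewrite gibbsE// ge0_integral_gibbs//; last 2 first.
- rewrite (_ : (fun x => _) = (fun x => (expR (g x - h x) *
      (fine (\int[P]_x (expR (h x))%:E) / fine (\int[P]_x (expR (g x))%:E)))%:E)).
    apply/measurable_funTS/measurable_EFinP/measurable_funM => //.
    by apply: measurableT_comp => //; exact: measurable_funB.
  apply/funext => x; rewrite /gibbs_ratio /gibbs_pdf expRD expRN invfM invrK.
  by congr EFin; ring.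
- by move=> x _; rewrite lee_fin divr_ge0// ltW// pdf_gt0.
apply: eq_integral => x _; rewrite /gibbs_ratio -EFinM divfK//.
by rewrite gt_eqF// pdf_gt0.
Qed.

End gibbs.

Section tilts.
Context {R : realType} {n : nat}.
Variable P : probability 'rV[R]_n R.

(* dP_l/dP is proportional to exp <l, x>.                                     *)
Definition tilt (l : 'rV[R]_n) : probability 'rV[R]_n R := gibbs P (dot l).

(* dQ/dP is proportional to exp (- <x, J x> / 2).                             *)
Definition reweighted (J : 'M[R]_n) : probability 'rV[R]_n R :=
  gibbs P (negquad J).

Definition covmx (mu : probability 'rV[R]_n R) : 'M[R]_n :=
  \matrix_(i, j) fine (covariance mu (fun x => x ord0 i) (fun x => x ord0 j)).

Definition msupport : set 'rV[R]_n :=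
  [set x | forall U : set 'rV[R]_n, open U -> U x -> (0 < P U)%E].

(* The continuous version of d(reweighted J)/d(tilt l).                       *)
Definition dreweighted_dtilt (J : 'M[R]_n) (l : 'rV[R]_n) : 'rV[R]_n -> R :=
  gibbs_ratio P (negquad J) (dot l).

Lemma dreweighted_dtiltE (J : 'M[R]_n) (l : 'rV[R]_n) (A : set 'rV[R]_n) :
  normalizable P (negquad J) -> normalizable P (dot l) -> measurable A ->
  reweighted J A = (\int[tilt l]_(x in A) (dreweighted_dtilt J l x)%:E)%E.
Proof. exact: gibbs_ratioE. Qed.

End tilts.

(* Algorithms are while-programs on a real-number random access machine with  *)
(* a sampling oracle. The memory has integer variables and two-dimensional    *)
(* arrays of real numbers, all indexed by nat. The programs do not depend on  *)
(* the dimension, and their only constants are natural numbers.               *)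
Inductive nexp : Type :=
| NVar of nat
| NCst of nat
| NAdd of nexp & nexp
| NSub of nexp & nexp.

(* RGet a i j is the entry (i, j) of the array a.                             *)
Inductive rexp : Type :=
| RGet of nat & nexp & nexp
| RNat of nexp
| RAdd of rexp & rexp
| RSub of rexp & rexp
| RMul of rexp & rexp
| RDiv of rexp & rexp.

Inductive bexp : Type :=
| BLeN of nexp & nexp
| BLeR of rexp & rexp
| BNot of bexp
| BAnd of bexp & bexp.

(* CReal a i j e assigns e to the entry (i, j) of the array a.                *)
(* CCoin x assigns a fair random bit to the integer variable x.               *)
(* CSample a b calls the oracle with the vector l held in row 0 of the array  *)
(* a and stores the sample, drawn from the distribution for l, in row 0 of    *)
(* the array b.                                                               *)
Inductive cmd : Type :=
| CNat of nat & nexp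
| CReal of nat & nexp & nexp & rexp
| CSeq of cmd & cmd
| CIf of bexp & cmd & cmd
| CWhile of bexp & cmd
| CCoin of nat
| CSample of nat & nat.

Section semantics.
Context {R : realType}.

Record state := State {
  nmem : nat -> nat;
  rmem : nat -> nat -> nat -> R;
  ncalls : nat }.

Implicit Type s : state.

Fixpoint neval s (e : nexp) : nat :=
  match e with
  | NVar x => nmem s x
  | NCst c => c
  | NAdd e1 e2 => (neval s e1 + neval s e2)%N
  | NSub e1 e2 => (neval s e1 - neval s e2)%N
  end.

Fixpoint reval s (e : rexp) : R :=
  match e with
  | RGet a i j => rmem s a (neval s i) (neval s j)
  | RNat e1 => (neval s e1)%:R
  | RAdd e1 e2 => reval s e1 + reval s e2
  | RSub e1 e2 => reval s e1 - reval s e2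
  | RMul e1 e2 => reval s e1 * reval s e2
  | RDiv e1 e2 => reval s e1 / reval s e2
  end.

Fixpoint beval s (b : bexp) : bool :=
  match b with
  | BLeN e1 e2 => (neval s e1 <= neval s e2)%N
  | BLeR e1 e2 => reval s e1 <= reval s e2
  | BNot b1 => ~~ beval s b1
  | BAnd b1 b2 => beval s b1 && beval s b2
  end.

Definition set_nat s (x v : nat) : state :=
  State (fun y => if y == x then v else nmem s y) (rmem s) (ncalls s).

Definition set_real s (a i j : nat) (r : R) : state :=
  State (nmem s)
    (fun a' i' j' => if [&& a' == a, i' == i & j' == j] then r
                     else rmem s a' i' j')
    (ncalls s).

Definition get_row n s (a : nat) : 'rV[R]_n := \row_(k < n) rmem s a 0%N k.

Definition answer n s (b : nat) (x : 'rV[R]_n) : state :=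
  State (nmem s)
    (fun a i j => if (a == b) && (i == 0%N) then
                    (if insub j is Some k then x ord0 k else rmem s a i j)
                  else rmem s a i j)
    (ncalls s).+1.

(* run D t post cs s is the probability that the list of commands cs, started *)
(* in state s, halts within t steps in a state that satisfies post. The       *)
(* integral is the expectation over the sample returned by the oracle, drawn  *)
(* from D l for the queried l independently of the past.                      *)
Fixpoint run n (D : 'rV[R]_n -> probability 'rV[R]_n R) (t : nat)
    (post : state -> Prop) (cs : seq cmd) s : \bar R :=
  match cs, t with
  | [::], _ => (`[< post s >]%:R)%:E
  | _ :: _, 0%N => 0%E
  | c :: cs', t'.+1 =>
    match c with
    | CNat x e => run D t' post cs' (set_nat s x (neval s e))
    | CReal a i j e =>
        run D t' post cs' (set_real s a (neval s i) (neval s j) (reval s e))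
    | CSeq c1 c2 => run D t' post [:: c1, c2 & cs'] s
    | CIf b c1 c2 => run D t' post ((if beval s b then c1 else c2) :: cs') s
    | CWhile b c1 =>
        run D t' post (if beval s b then [:: c1, c & cs'] else cs') s
    | CCoin x =>
        ((2^-1)%:E * (run D t' post cs' (set_nat s x 0) +
                      run D t' post cs' (set_nat s x 1)))%E
    | CSample a b =>
        (\int[D (get_row n s a)]_x run D t' post cs' (answer s b x))%E
    end
  end.

(* Variable 0 holds n, array 0 holds J, and row 0 of array 1 holds M, eps and *)
(* delta. The output is read from row 0 of array 2.                           *)
Definition input n (J : 'M[R]_n) (M eps delta : R) : state :=
  State (fun x => if x == 0%N then n else 0%N)
    (fun a i j =>
       match a, i, j with
       | 0%N, _, _ => if (insub i, insub j) is (Some i', Some j') then J i' j'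
                      else 0
       | 1%N, 0%N, 0%N => M
       | 1%N, 0%N, 1%N => eps
       | 1%N, 0%N, 2%N => delta
       | _, _, _ => 0
       end)
    0%N.

Definition output n s : 'rV[R]_n := get_row n s 2.

End semantics.

(* Main.v *)
Require Import Defs.
From HB Require Import structures.
From mathcomp Require Import all_boot all_order all_algebra.
From mathcomp Require Import all_classical all_reals all_analysis.
From mathcomp Require Import measurable_realfun ring lra zify.

Set Implicit Arguments.
Unset Strict Implicit.
Unset Printing Implicit Defensive.

Import Order.TTheory GRing.Theory Num.Theory.
Import numFieldNormedType.Exports.

Local Open Scope classical_set_scope.
Local Open Scope ring_scope.

(* Completing the square in - <x, J x> / 2 around a point u shows that, for the
   tilt by l = - J u,
     ln (dQ/dP_l) <= F u - ln Z_Q,  F u := <u, J u> / 2 + ln Z_l,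
   and Jensen's inequality bounds the right-hand side by
     Tr (J Cov P_l) / 2 + <g, J g> / 2 <= M Tr J / 2 + <g, J g> / 2,
   where g := u - E_{P_l} x. Since J g is the gradient of F, this is a
   Polyak-Lojasiewicz inequality for H u := F u - ln Z_Q - M Tr J / 2.
   The algorithm is stochastic gradient descent preconditioned by J^-1: draw
   x from P_l and replace u by u + eta (x - u). Only l = - J u is stored. In
   one step H changes by at most - eta <g, J g>, a centered noise whose variance
   is proportional to eta^2 <g, J g>, and O(eta^2). Hence E exp (t H) contracts
   as long as t eta is small, and Markov's inequality with t of order
   ln (1 / delta) / eps gives H <= eps with probability 1 - delta. *)

(** * Inner products, positive semidefinite forms and the operator norm *)

Section dot_theory.
Context {R : realType} {n : nat}.
Implicit Types (x y z : 'rV[R]_n) (A J : 'M[R]_n) (a : R).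

Lemma dotC x y : dot x y = dot y x.
Proof. by apply: eq_bigr => i _; rewrite mulrC. Qed.

Lemma dotDr x y z : dot x (y + z) = dot x y + dot x z.
Proof. by rewrite -big_split; apply: eq_bigr => i _; rewrite mxE mulrDr. Qed.

Lemma dotZr a x y : dot x (a *: y) = a * dot x y.
Proof. by rewrite mulr_sumr; apply: eq_bigr => i _; rewrite mxE mulrCA. Qed.

Lemma dotNr x y : dot x (- y) = - dot x y.
Proof. by rewrite -scaleN1r dotZr mulN1r. Qed.

Lemma dotBr x y z : dot x (y - z) = dot x y - dot x z.
Proof. by rewrite dotDr dotNr. Qed.

Lemma dotDl x y z : dot (x + y) z = dot x z + dot y z.
Proof. by rewrite dotC dotDr !(dotC z). Qed.

Lemma dotZl a x y : dot (a *: x) y = a * dot x y.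
Proof. by rewrite dotC dotZr dotC. Qed.

Lemma dotNl x y : dot (- x) y = - dot x y.
Proof. by rewrite dotC dotNr dotC. Qed.

Lemma dotBl x y z : dot (x - y) z = dot x z - dot y z.
Proof. by rewrite dotDl dotNl. Qed.

Lemma dot0r x : dot x 0 = 0.
Proof. by rewrite -(scale0r (0 : 'rV_n)) dotZr mul0r. Qed.

Lemma dot0l x : dot 0 x = 0.
Proof. by rewrite dotC dot0r. Qed.

Lemma mulvD A x y : mulv A (x + y) = mulv A x + mulv A y.
Proof. exact: mulmxDl. Qed.

Lemma mulvZ A a x : mulv A (a *: x) = a *: mulv A x.
Proof. exact: (esym (scalemxAl _ _ _)). Qed.

Lemma mulvN A x : mulv A (- x) = - mulv A x.
Proof. exact: mulNmx. Qed.

Lemma mulvB A x y : mulv A (x - y) = mulv A x - mulv A y.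
Proof. by rewrite mulvD mulvN. Qed.

Lemma mulv0 A : mulv A 0 = 0.
Proof. exact: mul0mx. Qed.

Lemma mulvE A x i : mulv A x ord0 i = \sum_j A i j * x ord0 j.
Proof. by rewrite mxE; apply: eq_bigr => j _; rewrite mxE mulrC. Qed.

Lemma dot_mulvE A x y :
  dot x (mulv A y) = \sum_i \sum_j x ord0 i * A i j * y ord0 j.
Proof.
apply: eq_bigr => i _; rewrite mulvE mulr_sumr.
by apply: eq_bigr => j _; rewrite mulrA.
Qed.

Lemma dot_mulv_delta A i j :
  dot (delta_mx ord0 i) (mulv A (delta_mx ord0 j)) = A i j.
Proof.
rewrite /dot (bigD1 i)//= big1 => [|k /negPf ki];
  last by rewrite mxE ki andbF mul0r.
rewrite mxE !eqxx mul1r addr0 mulvE (bigD1 j)//= big1 => [|k /negPf kj].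
  by rewrite mxE !eqxx mulr1 addr0.
by rewrite mxE kj andbF mulr0.
Qed.

Lemma dot_ge0 x : 0 <= dot x x.
Proof. by apply: sumr_ge0 => i _; rewrite -expr2 sqr_ge0. Qed.

Lemma dot_mulvC J x y : J^T = J -> dot x (mulv J y) = dot y (mulv J x).
Proof.
move=> Js; rewrite !dot_mulvE exchange_big; apply: eq_bigr => i _.
by apply: eq_bigr => j _; rewrite -{1}Js mxE; ring.
Qed.

Lemma psd_cauchy_schwarz J x y : psd J ->
  dot x (mulv J y) ^+ 2 <= quad J x * quad J y.
Proof.
move=> [Js J0]; have JC := dot_mulvC _ _ Js.
have E a b : quad J (a *: x + b *: y) =
    a ^+ 2 * quad J x + 2 * a * b * dot x (mulv J y) + b ^+ 2 * quad J y.
  rewrite /quad mulvD !mulvZ !dotDl !dotDr !dotZl !dotZr (JC y x); ring.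
set b := dot x _ in E *; have := J0 y; rewrite le_eqVlt => /predU1P[y0|y0].
  rewrite -y0 mulr0; have [->|b0] := eqVneq b 0; first by rewrite expr0n.
  have b2 : b ^+ 2 != 0 by rewrite sqrf_eq0.
  (* The coefficient of [y] is chosen so that the form takes the value -1, which contradicts
     positivity. *)
  have := J0 (1 *: x + (- (quad J x + 1) / (2 * b)) *: y).
  rewrite E -y0.
  have -> : 1 ^+ 2 * quad J x + 2 * 1 * (- (quad J x + 1) / (2 * b)) * b +
     (- (quad J x + 1) / (2 * b)) ^+ 2 * 0 = -1 by field.
  by rewrite ler0N1.
have := J0 (quad J y *: x + (- b) *: y); rewrite E.
have -> : quad J y ^+ 2 * quad J x + 2 * quad J y * - b * b +
    (- b) ^+ 2 * quad J y = quad J y * (quad J x * quad J y - b ^+ 2) by ring.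
by rewrite pmulr_rge0// subr_ge0.
Qed.

Lemma psd1 : psd (1%:M : 'M[R]_n).
Proof.
by split; [rewrite trmx1|move=> x; rewrite /quad /mulv trmx1 mulmx1 dot_ge0].
Qed.

Lemma dot_cauchy_schwarz x y : dot x y ^+ 2 <= dot x x * dot y y.
Proof.
by have := psd_cauchy_schwarz x y psd1; rewrite /quad /mulv !trmx1 !mulmx1.
Qed.

Lemma psd_diag_ge0 J i : psd J -> 0 <= J i i.
Proof. by move=> [_ /(_ (delta_mx ord0 i))]; rewrite /quad dot_mulv_delta. Qed.

(* Cholesky elimination of one index at a time. *)
Lemma psd_gram J : psd J ->
  exists vs : seq 'rV[R]_n,
    forall i j, J i j = \sum_(v <- vs) v ord0 i * v ord0 j.
Proof.
(* The induction is on the number of nonzero diagonal entries. *)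
have [k] := ubnP #|[pred i | J i i != 0]|.
elim: k J => // k IH J Jk pJ; have [Js J0] := pJ.
have [[i]|noi] := pselect (exists i, J i i != 0); last first.
  (* With a zero diagonal, Cauchy-Schwarz on basis vectors forces every entry of [J] to vanish. *)
  exists nil => i j; rewrite big_nil.
  have Jii : J i i = 0 by apply/eqP/negPn/negP => h; apply: noi; exists i.
  have := psd_cauchy_schwarz (delta_mx ord0 i) (delta_mx ord0 j) pJ.
  by rewrite /quad !dot_mulv_delta Jii mul0r exprn_even_le0//= => /eqP.
move=> Jii; pose v : 'rV[R]_n := (Num.sqrt (J i i))^-1 *: row i J.
have Ji0 := psd_diag_ge0 i pJ.
have vE (a b : 'I_n) : v ord0 a * v ord0 b = J i a * J i b / J i i.
  rewrite !mxE -{3}(sqr_sqrtr Ji0); field.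
  by rewrite sqrtr_eq0 -ltNge lt_def Jii.
(* [J'] is the Schur complement of the pivot [J i i]. It is positive by Cauchy-Schwarz between the
   basis vector of index [i] and [x]. Its diagonal entry at [i] vanishes and zero diagonal entries
   stay zero, so the induction measure drops. *)
pose J' := \matrix_(a, b) (J a b - v ord0 a * v ord0 b).
have JiE (a : 'I_n) : J a i = J i a by rewrite -{1}Js mxE.
have pJ' : psd J'.
  split; first by apply/matrixP => a b; rewrite !mxE mulrC -{1}Js mxE.
  move=> x; have -> : quad J' x = quad J x - dot v x ^+ 2.
    rewrite /quad !dot_mulvE expr2 {1}/dot mulr_suml -sumrB.
    apply: eq_bigr => c _; rewrite {1}/dot mulr_sumr -sumrB;
      apply: eq_bigr => d _.
    by rewrite !mxE; ring.
  rewrite subr_ge0.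
  have := psd_cauchy_schwarz (delta_mx ord0 i) x pJ.
  rewrite /quad dot_mulv_delta => h.
  have -> : dot v x ^+ 2 = dot (delta_mx ord0 i) (mulv J x) ^+ 2 / J i i.
    rewrite /v dotZl exprMn exprVn sqr_sqrtr// mulrC; congr (_ ^+ 2 / _).
    rewrite [RHS](bigD1 i)//= big1 => [|c /negPf ci];
      last by rewrite mxE ci andbF mul0r.
    rewrite mxE !eqxx mul1r addr0 mulvE.
    by apply: eq_bigr => c _; rewrite mxE.
  by rewrite ler_pdivrMr ?lt_def ?Jii// mulrC.
have [|vs vsE] := IH J' _ pJ'.
  move: Jk; rewrite ltnS; apply: leq_trans; apply: proper_card; apply/properP;
    split.
    apply/fintype.subsetP => a; rewrite !inE; apply: contra => /eqP Ja.
    rewrite mxE vE Ja.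
    have := psd_cauchy_schwarz (delta_mx ord0 i) (delta_mx ord0 a) pJ.
    rewrite /quad !dot_mulv_delta Ja mulr0 exprn_even_le0//= => /eqP Jia.
    by rewrite Jia mulr0 mul0r subrr.
  exists i; rewrite inE//; apply/negPn; rewrite mxE vE.
  by rewrite mulfK// subrr.
by exists (v :: vs) => i0 j0; rewrite big_cons -vsE [J' _ _]mxE addrC subrK.
Qed.

(** A Gram decomposition of [J] turns the trace of [J A] into a sum of values [quad A v], and the
    trace of [J] into the matching sum of squared norms. *)
Lemma psd_trace_le J A (M : R) : psd J -> (forall v, quad A v <= M * dot v v) ->
  \sum_i \sum_j J i j * A i j <= M * \tr J.
Proof.
move=> pJ AM; have [vs vsE] := psd_gram pJ.
have -> : \sum_i \sum_j J i j * A i j = \sum_(v <- vs) quad A v.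
  under eq_bigr => i _ do under eq_bigr => j _ do rewrite vsE mulr_suml.
  under eq_bigr => i _ do rewrite exchange_big.
  rewrite exchange_big; apply: eq_bigr => v _.
  rewrite /quad dot_mulvE; apply: eq_bigr => i _.
  by apply: eq_bigr => j _; ring.
have -> : \tr J = \sum_(v <- vs) dot v v.
  by rewrite exchange_big; apply: eq_bigr => i _; rewrite vsE.
by rewrite mulr_sumr; apply: ler_sum => v _.
Qed.

(** Each [|A i j|] is replaced by [1 + A i j ^+ 2], a polynomial in the entries that the program can
    evaluate with its arithmetic operations. *)
Lemma abs_dot_mulv_le A x y (a b : R) :
  (forall i, `|x ord0 i| <= a) -> (forall i, `|y ord0 i| <= b) ->
  `|dot x (mulv A y)| <= a * b * \sum_i \sum_j (1 + A i j ^+ 2).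
Proof.
move=> xa yb; rewrite dot_mulvE mulr_sumr.
apply: le_trans (ler_norm_sum _ _ _) _; apply: ler_sum => i _.
rewrite mulr_sumr.
apply: le_trans (ler_norm_sum _ _ _) _; apply: ler_sum => j _.
rewrite !normrM mulrAC.
have h : `|A i j| <= 1 + A i j ^+ 2.
  rewrite -[A i j ^+ 2]real_normK ?num_real//; have := normr_ge0 (A i j); nra.
by apply: ler_pM => //; apply: ler_pM.
Qed.

Lemma ler_enorm_coord x i : `|x ord0 i| <= enorm x.
Proof.
rewrite -sqrtr_sqr ler_sqrt ?dot_ge0// /dot (bigD1 i)//= -expr2 lerDl.
by apply: sumr_ge0 => j _; rewrite -expr2 sqr_ge0.
Qed.

Lemma enormZ a x : enorm (a *: x) = `|a| * enorm x.
Proof.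
by rewrite /enorm dotZl dotZr mulrA -expr2 sqrtrM ?sqr_ge0// sqrtr_sqr.
Qed.

(** This makes the supremum in [opnorm] a genuine least upper bound. Absolute row sums bound the
    image of the unit ball. *)
Lemma opnorm_set_sup A :
  has_sup [set enorm (mulv A x) | x in [set x | enorm x <= 1]].
Proof.
split.
  by exists (enorm (mulv A 0)), 0 => //=; rewrite /enorm dot0r sqrtr0.
exists (Num.sqrt (\sum_i (\sum_j `|A i j|) ^+ 2)) => _ [x /= x1 <-].
rewrite ler_sqrt; last by apply: sumr_ge0 => i _; rewrite sqr_ge0.
apply: ler_sum => i _; rewrite -expr2 -[leLHS]real_normK ?num_real//.
rewrite ler_pXn2r ?nnegrE ?sumr_ge0// mulvE.
apply: le_trans (ler_norm_sum _ _ _) _; apply: ler_sum => j _.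
rewrite normrM ler_piMr//; exact: le_trans (ler_enorm_coord _ _) x1.
Qed.

Lemma enorm_mulv_le A x : enorm x <= 1 -> enorm (mulv A x) <= opnorm A.
Proof.
move=> x1; apply: ub_le_sup; last by exists x.
by have [] := opnorm_set_sup A.
Qed.

Lemma opnorm_ge0 A : 0 <= opnorm A.
Proof.
apply: le_trans (enorm_mulv_le A (x := 0) _); first exact: sqrtr_ge0.
by rewrite /enorm dot0r sqrtr0.
Qed.

Lemma entry_le_opnorm A i j : `|A i j| <= opnorm A.
Proof.
have -> : A i j = mulv A (delta_mx ord0 j) ord0 i.
  rewrite mulvE (bigD1 j)//= big1 => [|k /negPf kj].
    by rewrite mxE !eqxx mulr1 addr0.
  by rewrite mxE kj andbF mulr0.
apply: le_trans (ler_enorm_coord _ _) _; apply: enorm_mulv_le.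
rewrite /enorm /dot (bigD1 j)//= big1 => [|k /negPf kj].
  by rewrite mxE !eqxx mulr1 addr0 sqrtr1.
by rewrite mxE kj andbF mulr0.
Qed.

Lemma quad_le_opnorm A x : quad A x <= opnorm A * dot x x.
Proof.
have [x0|x0] := eqVneq (dot x x) 0.
  rewrite x0 mulr0 /quad; have := dot_cauchy_schwarz x (mulv A x).
  by rewrite x0 mul0r exprn_even_le0//= => /eqP ->.
have e0 : 0 < enorm x by rewrite sqrtr_gt0 lt_def x0 dot_ge0.
have xE : dot x x = enorm x ^+ 2 by rewrite sqr_sqrtr// dot_ge0.
have : enorm (mulv A x) <= opnorm A * enorm x.
  rewrite -ler_pdivrMr// mulrC.
  have : enorm (mulv A ((enorm x)^-1 *: x)) <= opnorm A.
    by apply: enorm_mulv_le; rewrite enormZ ger0_norm ?invr_ge0 ?sqrtr_ge0//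
      mulVf// gt_eqF.
  by rewrite mulvZ enormZ ger0_norm// invr_ge0 sqrtr_ge0.
move=> h; rewrite xE expr2 mulrA.
apply: (@le_trans _ _ (enorm (mulv A x) * enorm x)); last by rewrite ler_pM2r.
have := dot_cauchy_schwarz x (mulv A x).
rewrite xE -[dot (mulv _ _) _]sqr_sqrtr ?dot_ge0// -exprMn mulrC => cs.
apply: le_trans (ler_norm _) _.
rewrite -(@ler_pXn2r _ 2) ?nnegrE ?mulr_ge0 ?sqrtr_ge0//.
by rewrite real_normK ?num_real.
Qed.

End dot_theory.

(** * Monotonicity of integrals for arbitrary functions *)

Section integral_nonmeasurable.
Context d (T : measurableType d) (R : realType).
Variable mu : {measure set T -> \bar R}.
Local Open Scope ereal_scope.

(** The integral of a nonnegative function is a supremum over the simple functions below it, and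
    this is monotone for all functions. It serves for [run], whose measurability in the sample is
    not established. *)
Lemma ge0_le_integralT (f g : T -> \bar R) : (forall x, 0 <= f x) ->
  (forall x, f x <= g x) -> \int[mu]_x f x <= \int[mu]_x g x.
Proof.
move=> f0 fg; have g0 x : 0 <= g x by apply: le_trans (fg x).
rewrite !ge0_integralTE//; apply: ereal_sup_le => _ [h /= hf <-].
by exists h => // x; apply: le_trans (fg x).
Qed.

(** The negative part of [f] only lowers the integral, and the positive part on [D], extended by
    zero, lies below [g]. *)
Lemma integral_le_ge0 (D : set T) (f g : T -> \bar R) : (forall x, 0 <= g x) ->
  (forall x, D x -> f x <= g x) -> \int[mu]_(x in D) f x <= \int[mu]_x g x.
Proof.
move=> g0 fg; rewrite integralE.
apply: (@le_trans _ _ (\int[mu]_(x in D) f^\+ x)).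
  rewrite -[leRHS]sube0 leeB//; apply: integral_ge0 => x _.
  exact: funeneg_ge0.
rewrite integral_mkcond; apply: ge0_le_integralT => x; rewrite patchE.
  by case: ifP => // _; exact: funepos_ge0.
case: ifPn => [/set_mem Dx|_//].
by rewrite funeposE ge_max fg/=.
Qed.

End integral_nonmeasurable.

(** * The cube around the sphere and functions bounded on it *)

Section box.
Context {R : realType} {n : nat}.
Implicit Types (x u w : 'rV[R]_n).

(** The cube circumscribed about the sphere. Unlike the sphere it is convex, so it contains the
    means of the tilts and all the iterates of the descent. *)
Definition box : set 'rV[R]_n :=
  [set x | forall i, `|x ord0 i| <= Num.sqrt n%:R].

Lemma measurable_box : measurable box.
Proof.
have -> : box = \bigcap_(i in [set: 'I_n])
    ((fun x : 'rV[R]_n => x ord0 i) @^-1` [set r | `|r| <= Num.sqrt n%:R]).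
  by apply/seteqP; split=> x xb i => [_|]; exact: xb.
apply: fin_bigcap_measurable => // i _.
rewrite -[X in measurable X]setTI; apply: measurable_coord => //.
have -> : [set r : R | `|r| <= Num.sqrt n%:R] =
    `[- Num.sqrt n%:R, Num.sqrt n%:R]%classic.
  by apply/seteqP; split=> r /=; rewrite in_itv/= ler_norml.
exact: measurable_itv.
Qed.

Lemma sphere_sub_box x : enorm x = Num.sqrt n%:R -> box x.
Proof. by move=> e i; rewrite -e; exact: ler_enorm_coord. Qed.

Lemma box0 : box 0.
Proof. by move=> i; rewrite mxE normr0 sqrtr_ge0. Qed.

Lemma box_convex u x (a : R) : 0 <= a <= 1 -> box u -> box x ->
  box (u + a *: (x - u)).
Proof.
move=> /andP[a0 a1] ub xb i; rewrite !mxE.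
have -> : u ord0 i + a * (x ord0 i - u ord0 i) =
  (1 - a) * u ord0 i + a * x ord0 i by ring.
apply: le_trans (ler_normD _ _) _;
  rewrite !normrM (ger0_norm a0) ger0_norm ?subr_ge0//.
have := ub i; have := xb i; nra.
Qed.

Lemma box_diff x u i : box x -> box u ->
  `|(x - u) ord0 i| <= 2 * Num.sqrt n%:R.
Proof.
move=> xb ub; rewrite !mxE mulr_natl mulr2n.
by apply: le_trans (ler_normB _ _) _; exact: lerD.
Qed.

Lemma box_form_le (J : 'M[R]_n) (K : R) x y u w :
  n%:R * \sum_i \sum_j (1 + J i j ^+ 2) <= K ->
  box x -> box y -> box u -> box w ->
  `|dot (x - y) (mulv J (u - w))| <= 4 * K.
Proof.
move=> hK xb yb ub wb.
apply: le_trans (abs_dot_mulv_le J (fun i => box_diff i xb yb)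
  (fun i => box_diff i ub wb)) _.
have -> : 2 * Num.sqrt n%:R * (2 * Num.sqrt n%:R) = 4 * n%:R :> R.
  by rewrite -[in RHS](@sqr_sqrtr _ n%:R)//; ring.
by rewrite -mulrA ler_pM2l.
Qed.

(** A class of functions closed under arithmetic and integrable on the cube for every probability
    measure carried by it. Integrability thereby becomes a syntactic check. *)
Definition boxfun (f : 'rV[R]_n -> R) : Prop :=
  measurable_fun setT f /\ exists c, forall x, box x -> `|f x| <= c.

Lemma boxfun_cst (a : R) : boxfun (fun=> a).
Proof. by split=> //; exists `|a|. Qed.

Lemma boxfun_coord i : boxfun (fun x => x ord0 i).
Proof.
by split; [exact: measurable_coord|exists (Num.sqrt n%:R) => x; apply].
Qed.

Lemma boxfunD f g : boxfun f -> boxfun g -> boxfun (fun x => f x + g x).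
Proof.
move=> [mf [a fa]] [mg [b gb]]; split; first exact: measurable_funD.
exists (a + b) => x xb; apply: le_trans (ler_normD _ _) _.
by rewrite lerD ?fa ?gb.
Qed.

Lemma boxfunM f g : boxfun f -> boxfun g -> boxfun (fun x => f x * g x).
Proof.
move=> [mf [a fa]] [mg [b gb]]; split; first exact: measurable_funM.
by exists (a * b) => x xb; rewrite normrM ler_pM ?fa ?gb.
Qed.

Lemma boxfunB f g : boxfun f -> boxfun g -> boxfun (fun x => f x - g x).
Proof.
move=> bf bg; have -> : (fun x => f x - g x) = (fun x => f x + (-1) * g x).
  by apply/funext => x; ring.
by apply: boxfunD => //; apply: boxfunM => //; exact: boxfun_cst.
Qed.

Lemma boxfun_sum I (r : seq I) (f : I -> 'rV[R]_n -> R) :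
  (forall i, boxfun (f i)) -> boxfun (fun x => \sum_(i <- r) f i x).
Proof.
move=> bf; elim: r => [|i r IH].
  by under eq_fun do rewrite big_nil; exact: boxfun_cst.
by under eq_fun do rewrite big_cons; exact: boxfunD.
Qed.

Lemma boxfun_dot_sub w u : boxfun (fun x => dot w (x - u)).
Proof.
apply: boxfun_sum => i; apply: boxfunM; first exact: boxfun_cst.
under eq_fun do rewrite !mxE.
by apply: boxfunB; [exact: boxfun_coord|exact: boxfun_cst].
Qed.

End box.
#[global] Hint Extern 0 (measurable box) => solve [apply: measurable_box] :
  core.
#[global] Hint Resolve boxfun_cst boxfun_coord boxfun_dot_sub : core.

(** * Expectations under a probability measure carried by the cube *)

Section box_expectation.
Context {R : realType} {n : nat}.
Variable mu : probability 'rV[R]_n R.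
Hypothesis mu_box : mu box = 1%E.
Implicit Types (f g : 'rV[R]_n -> R) (w u : 'rV[R]_n).

Definition bexpect f : R := \int[mu]_(x in box) f x.

Lemma boxfun_integrable f : boxfun f -> mu.-integrable box (EFin \o f).
Proof.
move=> [mf [c fc]]; apply: measurable_bounded_integrable => //.
- by rewrite [ltLHS]mu_box ltry.
- exact: measurable_funTS.
exists c; split; first by rewrite num_real.
by move=> y cy x /= xb; apply: le_trans (fc _ xb) (ltW cy).
Qed.

Lemma bexpectE f : boxfun f ->
  (bexpect f)%:E = (\int[mu]_(x in box) (f x)%:E)%E.
Proof.
by move=> bf; rewrite fineK//; apply: integrable_fin_num => //;
  exact: boxfun_integrable.
Qed.

Lemma bexpectD f g : boxfun f -> boxfun g ->
  bexpect (fun x => f x + g x) = bexpect f + bexpect g.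
Proof. by move=> bf bg; apply: RintegralD => //; exact: boxfun_integrable. Qed.

Lemma bexpectZ a f : boxfun f -> bexpect (fun x => a * f x) = a * bexpect f.
Proof. by move=> bf; apply: RintegralZl => //; exact: boxfun_integrable. Qed.

Lemma bexpect_cst a : bexpect (fun=> a) = a.
Proof. by rewrite /bexpect Rintegral_cst// [X in fine X]mu_box mulr1. Qed.

Lemma bexpect_sum I (r : seq I) (f : I -> 'rV[R]_n -> R) :
  (forall i, boxfun (f i)) ->
  bexpect (fun x => \sum_(i <- r) f i x) = \sum_(i <- r) bexpect (f i).
Proof.
move=> bf; elim: r => [|i r IH].
  under [X in bexpect X]eq_fun do rewrite big_nil.
  by rewrite bexpect_cst big_nil.
under [X in bexpect X]eq_fun do rewrite big_cons.
by rewrite bexpectD ?IH ?big_cons//; exact: boxfun_sum.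
Qed.

Lemma bexpect_le f g : boxfun f -> boxfun g -> (forall x, box x -> f x <= g x)
  ->
  bexpect f <= bexpect g.
Proof. by move=> bf bg fg; apply: le_Rintegral => //;
  exact: boxfun_integrable. Qed.

Lemma box_negligible : {ae mu, forall x, box x}.
Proof.
exists (~` box); split => //; first exact: measurableC.
by rewrite [LHS]probability_setC// [X in (_ - X)%E]mu_box subee.
Qed.

Lemma integral_box (f : 'rV[R]_n -> \bar R) : measurable_fun setT f ->
  (\int[mu]_x f x = \int[mu]_(x in box) f x)%E.
Proof.
move=> mf; rewrite [RHS]integral_mkcond; apply: ae_eq_integral => //.
  by apply/(measurable_restrictT _ _).1 => //; exact: measurable_funTS.
by apply: filterS box_negligible => x xb _; rewrite patchE mem_set.
Qed.

Definition mean : 'rV[R]_n := \row_i bexpect (fun x => x ord0 i).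

Lemma bexpect_centered w : bexpect (fun x => dot w (x - mean)) = 0.
Proof.
rewrite bexpect_sum; last first.
  move=> i; apply: boxfunM; first exact: boxfun_cst.
  under eq_fun do rewrite !mxE.
  by apply: boxfunB; [exact: boxfun_coord|exact: boxfun_cst].
apply: big1 => i _.
under [X in bexpect X]eq_fun do rewrite !mxE.
rewrite bexpectZ; last by apply: boxfunB.
by rewrite bexpectD// bexpect_cst subrr mulr0.
Qed.

Lemma mean_box : box mean.
Proof.
move=> i; rewrite mxE ler_norml; apply/andP; split.
  rewrite -[leLHS]bexpect_cst; apply: bexpect_le => // x /(_ i).
  by rewrite ler_norml => /andP[].
rewrite -[leRHS]bexpect_cst; apply: bexpect_le => // x /(_ i).
by rewrite ler_norml => /andP[].
Qed.

Lemma covmxE i j : covmx mu i j =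
  bexpect (fun x => (x ord0 i - mean ord0 i) * (x ord0 j - mean ord0 j)).
Proof.
have Efin k : fine 'E_mu[(fun x => x ord0 k)] = mean ord0 k.
  rewrite mxE unlock integral_box//; apply/measurable_EFinP.
  exact: measurable_coord.
rewrite mxE unlock !Efin unlock integral_box//.
apply/measurable_EFinP; apply: measurable_funM; apply: measurable_funB => //;
  exact: measurable_coord.
Qed.

(** The right-hand side is the trace of [J] times the covariance, written entrywise. *)
Lemma bexpect_quad (J : 'M[R]_n) :
  bexpect (fun x => quad J (x - mean)) = \sum_i \sum_j J i j * covmx mu i j.
Proof.
under [X in bexpect X]eq_fun do rewrite /quad dot_mulvE.
have bf i j : boxfun (fun x : 'rV[R]_n =>
    (x ord0 i - mean ord0 i) * (x ord0 j - mean ord0 j)).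
  by apply: boxfunM; apply: boxfunB.
have fE i j : (fun x : 'rV[R]_n => (x - mean) ord0 i * J i j * (x - mean) ord0
  j)
    = (fun x => J i j * ((x ord0 i - mean ord0 i) * (x ord0 j - mean ord0 j))).
  by apply/funext => x; rewrite !mxE; ring.
rewrite bexpect_sum => [|i]; last first.
  by apply: boxfun_sum => j; rewrite fE; exact: boxfunM.
apply: eq_bigr => i _; rewrite bexpect_sum => [|j]; last first.
  by rewrite fE; exact: boxfunM.
by apply: eq_bigr => j _; rewrite fE bexpectZ// covmxE.
Qed.

Lemma boxfun_quad_sub (J : 'M[R]_n) u : boxfun (fun x => quad J (x - u)).
Proof.
under eq_fun do rewrite /quad dot_mulvE.
do 2![apply: boxfun_sum => ?].
by do 2?apply: boxfunM => //; under eq_fun do rewrite !mxE; exact: boxfunB.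
Qed.

(** A linear term centered at the mean integrates to zero, so an affine minorant on the cube gives
    its constant as a lower bound. The affine function is integrable even when nothing is known
    about [f]. *)
Lemma integral_ge_affine (f : 'rV[R]_n -> \bar R) (a : R) w :
  (forall x, 0 <= f x)%E ->
  (forall x, box x -> ((a - dot w (x - mean))%:E <= f x)%E) ->
  (a%:E <= \int[mu]_x f x)%E.
Proof.
move=> f0 fa; apply: le_trans (integral_le_ge0 mu f0 fa).
rewrite -bexpectE; last by apply: boxfunB.
rewrite lee_fin bexpectD//; last first.
  by under eq_fun do rewrite -dotNl.
under [X in _ + bexpect X]eq_fun do rewrite -dotNl.
by rewrite bexpect_centered bexpect_cst addr0.
Qed.

Lemma integral_le_affine (f : 'rV[R]_n -> \bar R) (a : R) w :
  measurable_fun setT f -> (forall x, 0 <= f x)%E ->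
  (forall x, box x -> (f x <= (a + dot w (x - mean))%:E)%E) ->
  (\int[mu]_x f x <= a%:E)%E.
Proof.
move=> mf f0 fa; rewrite integral_box//.
have -> : a = bexpect (fun x => a + dot w (x - mean)).
  by rewrite bexpectD// bexpect_centered bexpect_cst addr0.
rewrite bexpectE; last exact: boxfunD.
apply: ge0_le_integral => //.
- exact: measurable_funTS.
- apply/measurable_funTS/measurable_EFinP; apply: measurable_funD => //.
  by have [] := boxfun_dot_sub w mean.
Qed.

End box_expectation.

(** * Elementary real inequalities *)

Lemma expR_le_quadratic (R : realType) (y : R) :
  `|y| <= 3^-1 -> expR y <= 1 + y + y ^+ 2.
Proof.
move=> /ler_normlP[y1 y2].
have h := expR_ge1Dx (- y / 2).
have a0 : 0 < 1 + - y / 2 by lra.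
have e0 := expR_gt0 y.
(* Together with [expR (- y / 2) >= 1 - y / 2] this gives [expR y * (1 - y / 2) ^+ 2 <= 1]. It then
   suffices that [1 + y + y ^+ 2] times the same square is at least 1, which holds once
   [3 * y <= 1]. *)
have E : expR y * expR (- y / 2) ^+ 2 = 1.
  by rewrite expr2 -!expRD -[RHS](expR0 R); congr expR; lra.
have h2 : expR y * (1 + - y / 2) ^+ 2 <= 1.
  by rewrite -[leRHS]E ler_pM2l// ler_pXn2r// nnegrE ltW// (lt_le_trans a0 h).
rewrite -(@ler_pM2r _ ((1 + - y / 2) ^+ 2)) ?exprn_gt0//.
apply: le_trans h2 _; rewrite -subr_ge0.
have -> : (1 + y + y ^+ 2) * (1 + - y / 2) ^+ 2 - 1 =
  y ^+ 2 * (1 - 3 * y + y ^+ 2) / 4 by field.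
by rewrite divr_ge0// mulr_ge0 ?sqr_ge0//; have := sqr_ge0 y; lra.
Qed.

Section arith.
Context {R : realFieldType}.
Implicit Types a b c e f q t v z K L eta : R.

Lemma gap_arith a b c e f q :
  a / 2 - e / 2 + b <= c -> e <= f + q -> 2 * (a / 2 + b - c - f / 2) <= q.
Proof. by lra. Qed.

Lemma descent_arith a b c q v K L1 L2 eta :
  eta ^+ 2 * v <= eta ^+ 2 * (4 * K ^+ 2) ->
  L1 <= L2 - eta * b + 16 * eta ^+ 2 * K ^+ 2 ->
  (a + 2 * eta * c + eta ^+ 2 * v) / 2 + L1 <= a / 2 + L2 - eta * q +
    eta * (c - b + q) + 18 * eta ^+ 2 * K ^+ 2.
Proof. by lra. Qed.

Lemma noise_arith a K : 12 * a * K <= 1 -> a * (4 * K) <= 3^-1.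
Proof. by lra. Qed.

Lemma variance_arith a z K : 12 * a * K <= 1 -> 0 <= z -> 4 * a * K * z <= z /
  2.
Proof. by move=> h z0; nra. Qed.

Lemma drift_arith t eta c f q z : 0 <= t * eta -> 2 * (f - c) <= q ->
  t * (f - c - eta * q + z) + t * eta * q / 2 <= t * ((1 - eta) * (f - c) + z).
Proof. by move=> h1 h2; nra. Qed.

End arith.

(** * Partition functions and change of measure *)

Section gibbs_partition.
Context d (T : measurableType d) (R : realType).
Variable P : probability T R.
Implicit Types h k : {mfun T >-> R}.

Definition partfun h : R := fine (\int[P]_x (expR (h x))%:E)%E.

Lemma partfunE h : normalizable P h ->
  (partfun h)%:E = (\int[P]_x (expR (h x))%:E)%E.
Proof. by move=> nh; rewrite fineK// ge0_fin_numE// integral_ge0// => x _;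
  rewrite lee_fin expR_ge0. Qed.

Lemma partfun_gt0 h : normalizable P h -> 0 < partfun h.
Proof. by move=> nh; rewrite -lte_fin partfunE// partition_gt0. Qed.

(** The density of [gibbs P k] cancels [expR (- k x)]. Ratios of partition functions thus become
    exponential moments, bounded above in [logZ_smooth] and below in [free_energy_gap]. *)
Lemma integral_gibbs_exp h k : normalizable P h -> normalizable P k ->
  (\int[gibbs P k]_x (expR (h x - k x))%:E = (partfun h / partfun k)%:E)%E.
Proof.
move=> nh nk; rewrite ge0_integral_gibbs//; last first.
  apply/measurable_EFinP; apply: measurableT_comp => //.
  exact: measurable_funB.
rewrite EFinM partfunE// -ge0_integralZr//; last 2 first.
- by apply/measurable_EFinP; exact: measurableT_comp.
- by rewrite lee_fin invr_ge0 ltW// partfun_gt0.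
apply: eq_integral => x _; rewrite -!EFinM /gibbs_pdf -/(partfun k).
by rewrite mulrA -expRD subrK.
Qed.

End gibbs_partition.

(** * The free energy: Jensen bound, smoothness and one descent step *)

Section free_energy.
Context {R : realType} {n : nat}.
Variables (P : probability 'rV[R]_n R) (J : 'M[R]_n).
Hypotheses (P_box : P box = 1%E) (psdJ : psd J).
Implicit Types (x u l h : 'rV[R]_n).

Lemma normalizable_dot l : normalizable P (dot l).
Proof.
apply: (@bounded_normalizable _ _ _ _ _ (\sum_i `|l ord0 i| * Num.sqrt n%:R)).
apply: filterS (box_negligible P_box) => x xb.
apply: ler_sum => i _; apply: le_trans (ler_norm _) _.
by rewrite normrM ler_wpM2l.
Qed.

Lemma normalizable_negquad : normalizable P (negquad J).
Proof.
apply: (@bounded_normalizable _ _ _ _ _ 0); apply: filterE => x.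
by have := psdJ.2 x; rewrite /= /negquad; lra.
Qed.

Lemma tilt_box l : tilt P l box = 1%E.
Proof.
have mC : measurable (~` box : set 'rV[R]_n) by apply: measurableC.
have nl := normalizable_dot l.
have PC : P (~` box) = 0%E.
  by rewrite [LHS]probability_setC// [X in (_ - X)%E]P_box subee.
have : tilt P l (~` box) = 0%E.
  rewrite [LHS]gibbsE//; apply: null_set_integral => //.
  apply/measurable_EFinP/measurable_funTS; apply: measurable_funM => //.
  apply: measurableT_comp => //; exact: measurable_dot.
move=> h; rewrite -[box]setCK [LHS]probability_setC//.
by rewrite [X in (_ - X)%E]h sube0.
Qed.

Definition logZ l : R := ln (partfun P (dot l)).
Definition mfield u : 'rV[R]_n := - mulv J u.
Definition tmean u : 'rV[R]_n := mean (tilt P (mfield u)).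

(* Minimized where u is the mean of the tilt by - J u. *)
Definition free_energy u : R := quad J u / 2 + logZ (mfield u).

Lemma tmean_box u : box (tmean u).
Proof. exact/mean_box/tilt_box. Qed.

Lemma quadB x u : quad J (x - u) = quad J x - 2 * dot u (mulv J x) + quad J u.
Proof.
rewrite /quad mulvB !dotBl !dotBr (dot_mulvC x u psdJ.1); ring.
Qed.

Lemma quadDZ u x (a : R) : quad J (u + a *: x) =
  quad J u + 2 * a * dot u (mulv J x) + a ^+ 2 * quad J x.
Proof.
rewrite /quad mulvD mulvZ !dotDl !dotDr !dotZl !dotZr.
by rewrite (dot_mulvC x u psdJ.1); ring.
Qed.

(** Completing the square: the tilt by [- J u] is the linearization of the quadratic weight at [u],
    up to a constant. *)
Lemma negquad_tilt x u : negquad J x - dot (mfield u) x =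
  quad J u / 2 - quad J (x - u) / 2.
Proof.
rewrite quadB /negquad /mfield dotNl (dotC _ x) (dot_mulvC x u psdJ.1).
by field.
Qed.

(** After completing the square, the only term that depends on [x] is [- quad J (x - u) / 2], which
    is nonpositive. *)
Lemma ln_dreweighted_dtilt_le u x :
  ln (dreweighted_dtilt P J (mfield u) x) <=
  free_energy u - ln (partfun P (negquad J)).
Proof.
have Zl := partfun_gt0 (normalizable_dot (mfield u)).
have Zq := partfun_gt0 normalizable_negquad.
have -> : dreweighted_dtilt P J (mfield u) x =
    expR (negquad J x - dot (mfield u) x) *
    (partfun P (dot (mfield u)) / partfun P (negquad J)).
  rewrite /dreweighted_dtilt /gibbs_ratio /gibbs_pdf -/(partfun _ _).
  rewrite -/(partfun P (dot _)) expRD expRN invf_div.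
  by ring.
rewrite lnM ?posrE ?expR_gt0 ?divr_gt0// expRK ln_div ?posrE//.
rewrite negquad_tilt /free_energy /logZ.
by rewrite -[leRHS]addrA lerD2r gerBl divr_ge0// psdJ.2.
Qed.

(** The ratio of partition functions is the mean of [expR (dot h x)] under the tilt by [l]. A second
    order expansion around the mean loses its linear term on integration, leaving the factor
    [1 + v <= expR v]. *)
Lemma logZ_smooth l h (v : R) :
  (forall x, box x -> `|dot h (x - mean (tilt P l))| <= 3^-1 /\
                      dot h (x - mean (tilt P l)) ^+ 2 <= v) ->
  logZ (l + h) <= logZ l + dot h (mean (tilt P l)) + v.
Proof.
set m := mean _ => hv.
have Zl := partfun_gt0 (normalizable_dot l).
have Zlh := partfun_gt0 (normalizable_dot (l + h)).
have : ((partfun P (dot (l + h)) / partfun P (dot l))%:E <=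
    (expR (dot h m) * (1 + v))%:E)%E.
  rewrite -integral_gibbs_exp; [|exact: normalizable_dot..].
  apply: (@integral_le_affine _ _ _ (tilt_box l) _ _ (expR (dot h m) *: h)).
  - apply/measurable_EFinP; apply: measurableT_comp => //.
    by apply: measurable_funB; exact: measurable_dot.
  - by move=> x; rewrite lee_fin expR_ge0.
  move=> x xb; rewrite lee_fin /= dotDl addrAC subrr add0r.
  have [h1 h2] := hv x xb.
  have -> : dot h x = dot h m + dot h (x - m) by rewrite dotBr; ring.
  rewrite expRD dotZl -mulrDr ler_pM2l ?expR_gt0//.
  by apply: le_trans (expR_le_quadratic h1) _; rewrite -/m [leRHS]addrAC lerD2l.
rewrite lee_fin ler_pdivrMr// => hZ.
rewrite /logZ -addrA -[dot h m + v]expRK [leRHS]addrC -lnM ?posrE ?expR_gt0//.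
rewrite ler_ln ?posrE ?mulr_gt0 ?expR_gt0//; apply: le_trans hZ _.
by rewrite ler_pM2r// expRD ler_pM2l ?expR_gt0// expR_ge1Dx.
Qed.

(** Bias-variance decomposition around the mean of the tilt: the variance is the trace of [J] times
    the covariance, and the bias is [quad J (u - tmean u)]. *)
Lemma tilted_quad_le (M : R) u : opnorm (covmx (tilt P (mfield u))) <= M ->
  bexpect (tilt P (mfield u)) (fun x => quad J (x - u)) <=
  M * \tr J + quad J (u - tmean u).
Proof.
move=> hM; have tb := tilt_box (mfield u); set mu := tilt _ _ in hM tb *.
pose m := mean mu.
have -> : (fun x => quad J (x - u)) = (fun x => quad J (x - m) +
    (dot (2 *: mulv J (m - u)) (x - m) + quad J (u - m))).
  apply/funext => x; have -> : x - u = (x - m) - (u - m).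
    by rewrite opprB addrA subrK.
  rewrite quadB dotZl (dotC (mulv _ _)) -[m - u]opprB mulvN dotNr.
  by rewrite (dot_mulvC (x - m) _ psdJ.1); ring.
rewrite !bexpectD//; last 2 first.
  exact: boxfun_quad_sub.
  exact: boxfunD.
rewrite bexpect_centered// bexpect_cst// add0r lerD2r bexpect_quad//.
apply: psd_trace_le => // v; apply: le_trans (quad_le_opnorm _ _) _.
by rewrite ler_wpM2r// dot_ge0.
Qed.

Lemma free_energy_gap (M : R) u : opnorm (covmx (tilt P (mfield u))) <= M ->
  2 * (free_energy u - ln (partfun P (negquad J)) - M * \tr J / 2) <=
  quad J (u - tmean u).
Proof.
move=> hM; have := tilted_quad_le hM; have tb := tilt_box (mfield u).
set mu := tilt _ _ in hM tb *; set e := bexpect _ _ => he.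
have Zl := partfun_gt0 (normalizable_dot (mfield u)).
have Zq := partfun_gt0 normalizable_negquad.
(* [c] is the mean of the exponent in the integral for the ratio of partition functions. Jensen's
   inequality is applied below in the form of the tangent to the exponential at [c]. *)
pose c := quad J u / 2 - e / 2.
have : ((expR c)%:E <=
    (partfun P (negquad J) / partfun P (dot (mfield u)))%:E)%E.
  rewrite -integral_gibbs_exp; [|exact: normalizable_negquad|exact:
    normalizable_dot].
  have bq := boxfun_quad_sub J u.
  have bh : boxfun (fun x => (- 2^-1) * quad J (x - u)) by apply: boxfunM.
  have -> : expR c = bexpect mu (fun x =>
      expR c * (1 + e / 2 + - 2^-1 * quad J (x - u))).
    rewrite bexpectZ//; last exact: boxfunD.
    by rewrite bexpectD// bexpectZ// bexpect_cst// -/e -[LHS]mulr1;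
      congr (_ * _); field.
  rewrite bexpectE//; last by apply: boxfunM => //; exact: boxfunD.
  apply: integral_le_ge0 => x; first by rewrite lee_fin expR_ge0.
  move=> _; rewrite lee_fin negquad_tilt.
  have -> : quad J u / 2 - quad J (x - u) / 2 = c + (e / 2 - quad J (x - u) /
    2).
    by rewrite /c; field.
  rewrite [expR (c + _)]expRD ler_pM2l ?expR_gt0//;
    apply: le_trans (expR_ge1Dx _).
  by rewrite mulNr [_^-1 * _]mulrC addrA.
rewrite lee_fin ler_pdivlMr// => hZ.
move: hZ; rewrite -(ler_ln (x := expR c * _)) ?posrE ?mulr_gt0 ?expR_gt0//.
rewrite lnM ?posrE ?expR_gt0// expRK /free_energy -/(logZ _) /c.
by move=> h; exact: gap_arith h he.
Qed.

(** The quadratic part is expanded exactly and [logZ_smooth] handles the rest. The constant 18 is 2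
    from [eta ^+ 2 * quad J (x - u) / 2] plus 16 from the square of [eta * (4 * K)]. *)
Lemma free_energy_descent (K eta : R) u x : 1 <= K ->
  n%:R * \sum_i \sum_j (1 + J i j ^+ 2) <= K ->
  0 <= eta -> 4 * eta * K <= 3^-1 -> box u -> box x ->
  free_energy (u + eta *: (x - u)) <= free_energy u
    - eta * quad J (u - tmean u)
    + eta * dot (mulv J (u - tmean u)) (x - tmean u) + 18 * eta ^+ 2 * K ^+ 2.
Proof.
move=> K1 hK eta0 etaK ub xb; set m := tmean u; set dd := x - u.
have bil4 y z : box y -> box z -> `|dot (y - z) (mulv J dd)| <= 4 * K.
  by move=> yb zb; exact: box_form_le.
have mE : mfield (u + eta *: dd) = mfield u + - (eta *: mulv J dd).
  by rewrite /mfield mulvD mulvZ opprD.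
have := @logZ_smooth (mfield u) (- (eta *: mulv J dd)) (16 * eta ^+ 2 * K ^+ 2).
rewrite -mE -/(tmean u) -/m dotNl dotZl (dotC _ m) => hs.
have {hs}hs := hs _.
have qd : quad J dd <= 4 * K.
  by apply: le_trans (ler_norm _) (bil4 _ _ xb ub).
have gE : dot (mulv J (u - m)) (x - m) =
    dot u (mulv J dd) - dot m (mulv J dd) + quad J (u - m).
  rewrite (dotC _ (x - m)) (dot_mulvC _ _ psdJ.1).
  have -> : x - m = dd + (u - m) by rewrite addrA subrK.
  by rewrite mulvD dotDr dotBl.
rewrite /free_energy quadDZ gE.
suff h2 : logZ (mfield (u + eta *: dd)) <= logZ (mfield u) -
    eta * dot m (mulv J dd) + 16 * eta ^+ 2 * K ^+ 2.
  have : eta ^+ 2 * quad J dd <= eta ^+ 2 * (4 * K ^+ 2).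
    rewrite ler_wpM2l ?sqr_ge0//; apply: le_trans qd _.
    by rewrite ler_pM2l// expr2 ler_peMr// (le_trans ler01 K1).
  by move=> hq; exact: descent_arith hq h2.
apply: hs => y yb; rewrite dotNl dotZl (dotC _ (y - m)).
have h := bil4 y m yb (tmean_box u).
rewrite normrN normrM ger0_norm// sqrrN exprMn; split.
  by apply: le_trans etaK; rewrite mulrAC [leRHS]mulrC ler_wpM2l.
rewrite [leRHS](_ : _ = eta ^+ 2 * (4 * K) ^+ 2); last by ring.
rewrite ler_wpM2l ?sqr_ge0// -[leLHS]real_normK ?num_real//.
by rewrite ler_pXn2r ?nnegrE//; rewrite mulr_ge0// (le_trans ler01 K1).
Qed.

(* The variance of the noise term is proportional to quad J g, hence is
   absorbed by the drift - eta * quad J g when t * eta is small. *)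
Lemma exp_free_energy_step (K eta t c : R) u : 1 <= K ->
  n%:R * \sum_i \sum_j (1 + J i j ^+ 2) <= K ->
  0 <= eta -> 4 * eta * K <= 3^-1 -> 0 <= t -> 12 * (t * eta) * K <= 1 ->
  box u -> 2 * (free_energy u - c) <= quad J (u - tmean u) ->
  exists w, forall x, box x ->
    expR (t * (free_energy (u + eta *: (x - u)) - c)) <=
    expR (t * ((1 - eta) * (free_energy u - c) + 18 * eta ^+ 2 * K ^+ 2)) +
    dot w (x - tmean u).
Proof.
move=> K1 hK eta0 etaK t0 tK ub gap; set g := u - tmean u in gap *.
set m := tmean u in g gap *; set q := quad J g in gap *.
have q0 : 0 <= q by exact: psdJ.2.
(* [A0] is the deterministic factor of the exponential. The witness below is [A0] times the gradient
   of the noise [y], so that its pairing with [x - m] is [A0 * y]. *)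
pose A0 := expR (t * (free_energy u - c - eta * q + 18 * eta ^+ 2 * K ^+ 2)).
exists ((A0 * (t * eta)) *: mulv J g) => x xb.
have dsc := free_energy_descent K1 hK eta0 etaK ub xb.
rewrite -/m -/g -/q in dsc.
pose y := t * eta * dot (mulv J g) (x - m).
have bil4 v z : box v -> box z -> `|dot (v - m) (mulv J (z - m))| <= 4 * K.
  by move=> vb zb; apply: box_form_le => //; exact: tmean_box.
have te0 : 0 <= t * eta by exact: mulr_ge0.
have y1 : `|y| <= 3^-1.
  rewrite /y normrM (ger0_norm te0) (dotC _ (x - m)).
  have := bil4 x u xb ub; rewrite -/g => h.
  apply: (@le_trans _ _ (t * eta * (4 * K))); first by rewrite ler_wpM2l.
  exact: noise_arith.
(* Cauchy-Schwarz for the form [J] bounds the squared noise by a multiple of [q], and the smallness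
   of [t * eta * K] brings it below half of the drift. *)
have y2 : y ^+ 2 <= t * eta * q / 2.
  rewrite /y exprMn (dotC _ (x - m)).
  have cs := psd_cauchy_schwarz (x - m) g psdJ; rewrite -/q in cs.
  have qx : quad J (x - m) <= 4 * K.
    by apply: le_trans (ler_norm _) (bil4 _ _ xb xb).
  have : quad J (x - m) * q <= 4 * K * q by rewrite ler_wpM2r.
  set b2 := dot _ _ ^+ 2 in cs * => qx2.
  have : (t * eta) ^+ 2 * b2 <= (t * eta) ^+ 2 * (4 * K * q).
    by rewrite ler_wpM2l ?sqr_ge0// (le_trans cs).
  move=> h; apply: le_trans h _.
  have -> : (t * eta) ^+ 2 * (4 * K * q) = (4 * (t * eta) * K) * (t * eta * q).
    by ring.
  have : 0 <= t * eta * q by exact: mulr_ge0.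
  by move=> h0; exact: variance_arith.
apply: (@le_trans _ _ (A0 * expR y)).
  rewrite -expRD ler_expR.
  have -> : t * (free_energy u - c - eta * q + 18 * eta ^+ 2 * K ^+ 2) + y =
    t * (free_energy u - eta * q + eta * dot (mulv J g) (x - m) +
         18 * eta ^+ 2 * K ^+ 2 - c) by rewrite /y; ring.
  by rewrite ler_wpM2l// lerD2r.
apply: (@le_trans _ _ (A0 * (1 + t * eta * q / 2) + A0 * y)).
  rewrite -mulrDr ler_wpM2l ?expR_ge0//.
  by apply: le_trans (expR_le_quadratic y1) _; rewrite [leRHS]addrAC lerD2l.
rewrite dotZl -[A0 * (t * eta) * _]mulrA -/y lerD2r.
(* The variance moves into the exponent, where half of the drift absorbs it. The other half gives
   the contraction by [1 - eta] through the gap hypothesis. *)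
apply: (@le_trans _ _ (A0 * expR (t * eta * q / 2))).
  by rewrite ler_wpM2l ?expR_ge0// expR_ge1Dx.
rewrite -expRD ler_expR.
exact: drift_arith.

Qed.

End free_energy.

(** * Rules for bounding the success probability of programs *)

Section run_theory.
Context {R : realType} {n : nat}.
Variable D : 'rV[R]_n -> probability 'rV[R]_n R.
Implicit Types (post : @state R -> Prop) (s : @state R) (cs : seq cmd).

Lemma run_ge0 t post cs s : (0 <= run D t post cs s)%E.
Proof.
elim: t cs s => [|t IH] [|c cs] s //=; [by rewrite lee_fin ler0n..|].
case: c => //= [x|a b].
  by rewrite mule_ge0 ?lee_fin ?invr_ge0// adde_ge0.
by apply: integral_ge0 => x _; exact: IH.
Qed.

Lemma run_le1 t post cs s : (run D t post cs s <= 1)%E.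
Proof.
elim: t cs s => [|t IH] [|c cs] s //=; [by rewrite lee_fin lern1 leq_b1..|].
case: c => //= [x|a b].
  have -> : 1%E = ((2^-1)%:E * (1 + 1))%E :> \bar R.
    by rewrite -EFinD -EFinM; congr EFin; field.
  by rewrite lee_pmul2l ?lte_fin ?invr_gt0// leeD.
apply: (@le_trans _ _ (\int[D (get_row n s a)]_x 1)%E).
  by apply: ge0_le_integralT => x; [exact: run_ge0|exact: IH].
by rewrite integral_cst//= mul1e probability_le1.
Qed.

(** A step makes at most one oracle call, so the bound holds in every state reached within [t]
    steps. *)
Lemma run_ncalls t m cs s : (ncalls s + t <= m)%N ->
  run D t (fun s' => (ncalls s' <= m)%N) cs s = run D t (fun=> True) cs s.
Proof.
elim: t cs s => [|t IH] [|c cs] s h //=.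
1,2: by congr ((_)%:R%:E); congr nat_of_bool;
  apply: asbool_equiv_eq; split => // _; lia.
have ht : (ncalls s + t <= m)%N by lia.
case: c => //= [x e|a i j e|c1 c2|b c1 c2|b c|x|a b]; rewrite ?IH//.
by apply: eq_integral => x _; rewrite IH//=; lia.
Qed.

(** Quantifying over all larger budgets lets fragments that halt early be composed from upper bounds
    on their running times. *)
Definition success_ge post (a : R) t cs s : Prop :=
  forall t', (t <= t')%N -> (a%:E <= run D t' post cs s)%E.

Lemma success_ge_nil post a t s : a <= `[< post s >]%:R ->
  success_ge post a t [::] s.
Proof. by move=> h [|t'] _ /=; rewrite lee_fin. Qed.

Lemma success_ge_seq post a t c1 c2 cs s :
  success_ge post a t [:: c1, c2 & cs] s ->
  success_ge post a t.+1 (CSeq c1 c2 :: cs) s.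
Proof. by move=> h [|t']//= tt'; exact: h. Qed.

Lemma success_ge_whileT post a t b c cs s : beval s b ->
  success_ge post a t [:: c, CWhile b c & cs] s ->
  success_ge post a t.+1 (CWhile b c :: cs) s.
Proof. by move=> bs h [|t']//= tt'; rewrite bs; exact: h. Qed.

Lemma success_ge_whileF post a t b c cs s : ~~ beval s b ->
  success_ge post a t cs s -> success_ge post a t.+1 (CWhile b c :: cs) s.
Proof. by move=> /negPf bs h [|t']//= tt'; rewrite bs; exact: h. Qed.

(** The bound after the call may depend on the sample through a linear term centered at the mean of
    the queried distribution, since this term averages out. *)
Lemma success_ge_sample post a t i j cs s w :
  D (get_row n s i) box = 1%E ->
  (forall x, box x ->
    success_ge post (a - dot w (x - mean (D (get_row n s i)))) t cs
      (answer s j x)) ->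
  success_ge post a t.+1 (CSample i j :: cs) s.
Proof.
move=> Db h [|t']//= tt'; apply: (integral_ge_affine Db (w := w)).
  by move=> x; exact: run_ge0.
by move=> x xb; exact: h.
Qed.

(* For commands that neither sample nor toss a coin when run from s. *)
Definition reaches c s k (Q : @state R -> Prop) : Prop :=
  exists k' s', [/\ (k' <= k)%N, Q s' &
    forall t post cs, run D (k' + t) post (c :: cs) s = run D t post cs s'].

Lemma success_ge_reaches post a t k c cs s Q : reaches c s k Q ->
  (forall s', Q s' -> success_ge post a t cs s') ->
  success_ge post a (k + t) (c :: cs) s.
Proof.
move=> [k' [s' [k'k Qs' E]]] h t' tt'.
have -> : t' = (k' + (t' - k'))%N by lia.
by rewrite E; apply: h => //; lia.
Qed.

Lemma reaches_le c s k1 k2 (Q1 Q2 : @state R -> Prop) : (k1 <= k2)%N ->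
  (forall s', Q1 s' -> Q2 s') -> reaches c s k1 Q1 -> reaches c s k2 Q2.
Proof.
move=> kk QQ [k' [s' [k'k Qs' E]]]; exists k', s'; split => //.
  exact: leq_trans kk.
exact: QQ.
Qed.

Lemma reaches_nat x e s (Q : @state R -> Prop) :
  Q (set_nat s x (neval s e)) -> reaches (CNat x e) s 1 Q.
Proof. by move=> Qs; eexists 1%N, _; split => //. Qed.

Lemma reaches_real a i j e s (Q : @state R -> Prop) :
  Q (set_real s a (neval s i) (neval s j) (reval s e)) ->
  reaches (CReal a i j e) s 1 Q.
Proof. by move=> Qs; eexists 1%N, _; split => //. Qed.

Lemma reaches_seq c1 c2 s k1 k2 (Q1 Q : @state R -> Prop) :
  reaches c1 s k1 Q1 -> (forall s', Q1 s' -> reaches c2 s' k2 Q) ->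
  reaches (CSeq c1 c2) s (k1 + k2).+1 Q.
Proof.
move=> [l1 [s1 [l1k Qs1 E1]]] /(_ _ Qs1)[l2 [s2 [l2k Qs2 E2]]].
exists (l1 + l2).+1, s2; split => //; first by lia.
by move=> t post cs; rewrite addSn /= -addnA E1 E2.
Qed.

(* The index of the invariant is the number of remaining iterations. *)
Lemma reaches_while b c k (I : nat -> @state R -> Prop) :
  (forall s, I 0 s -> ~~ beval s b) ->
  (forall m s, I m.+1 s -> beval s b /\ reaches c s k (I m)) ->
  forall m s, I m s -> reaches (CWhile b c) s (m * k.+1).+1 (I 0).
Proof.
move=> I0 IS; elim=> [|m IH] s Is.
  exists 1%N, s; split => // t post cs.
  by rewrite add1n /= (negPf (I0 _ Is)).
have [bs [k1 [s1 [k1k Is1 E1]]]] := IS _ _ Is.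
have [k2 [s2 [k2k Is2 E2]]] := IH _ Is1.
exists (k1 + k2).+1, s2; split => //; first by rewrite mulSn; lia.
by move=> t post cs; rewrite addSn /= bs -addnA E1 E2.
Qed.

(* Iterates the body for i = 0, ..., n - 1, where n is the variable 0. *)
Definition cfor i c : cmd :=
  CSeq (CNat i (NCst 0))
    (CWhile (BNot (BLeN (NVar 0) (NVar i)))
      (CSeq c (CNat i (NAdd (NVar i) (NCst 1))))).

Lemma reaches_for N i c k (I : nat -> @state R -> Prop) s :
  (forall j s', I j s' -> nmem s' 0 = N) ->
  (forall j s' v, I j s' -> I j (set_nat s' i v)) ->
  (forall j s', (j < N)%N -> I j s' -> nmem s' i = j ->
    reaches c s' k (fun s2 => I j.+1 s2 /\ nmem s2 i = j)) ->
  I 0 s -> reaches (cfor i c) s (N * k.+3 + 3)%N (I N).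
Proof.
move=> IN Iset Ibody I0.
have W := @reaches_while (BNot (BLeN (NVar 0) (NVar i)))
  (CSeq c (CNat i (NAdd (NVar i) (NCst 1)))) k.+2
  (fun m s' => [/\ (m <= N)%N, I (N - m)%N s' & nmem s' i = (N - m)%N]).
(* Each iteration costs the body plus three steps: the guard, the sequencing and the increment. The
   three extra steps are the outer sequencing, the initialization and the last guard. *)
apply: (@reaches_le _ _ (1 + (N * k.+3).+1).+1 _ (fun s' =>
    [/\ (0 <= N)%N, I (N - 0)%N s' & nmem s' i = (N - 0)%N])).
- by lia.
- by move=> s' []; rewrite subn0.
apply: (reaches_seq (Q1 := fun s' => I 0 s' /\ nmem s' i = 0%N)).
  apply: reaches_nat; split; first exact: Iset.
  by rewrite /= eqxx.
move=> s' [Is' s'i]; apply: W => [s1 [_ Is1 s1i]|m s1 [mN Is1 s1i]|].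
- by rewrite /= (IN _ _ Is1) s1i subn0 leqnn.
- split; first by rewrite /= (IN _ _ Is1) s1i; lia.
  have -> : k.+2 = (k + 1).+1 by lia.
  apply: (reaches_seq (Ibody _ _ _ Is1 s1i)); first by lia.
  move=> s2 [Is2 s2i]; apply: reaches_nat.
  have E : (N - m.+1).+1 = (N - m)%N by lia.
  rewrite E in Is2.
  by split; [lia|exact: Iset|rewrite /= eqxx s2i -E addn1].
- by rewrite subnn; split.
Qed.

End run_theory.

(** * The program *)

(* Array 4 accumulates the sum of 1 + J i j ^+ 2. *)
Definition sum_cmd : cmd :=
  cfor 1 (cfor 2 (CReal 4 (NCst 0) (NCst 0)
    (RAdd (RGet 4 (NCst 0) (NCst 0))
      (RAdd (RNat (NCst 1))
        (RMul (RGet 0 (NVar 1) (NVar 2)) (RGet 0 (NVar 1) (NVar 2))))))).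

(* Variable 3 is L and array 5 holds 2 ^+ L * delta. *)
Definition log_cmd : cmd :=
  CSeq (CReal 5 (NCst 0) (NCst 0) (RGet 1 (NCst 0) (NCst 2)))
    (CWhile (BNot (BLeR (RNat (NCst 1)) (RGet 5 (NCst 0) (NCst 0))))
      (CSeq (CReal 5 (NCst 0) (NCst 0)
              (RAdd (RGet 5 (NCst 0) (NCst 0)) (RGet 5 (NCst 0) (NCst 0))))
            (CNat 3 (NAdd (NVar 3) (NCst 1))))).

Definition bound_rexp : rexp :=
  RAdd (RNat (NCst 1)) (RMul (RNat (NVar 0)) (RGet 4 (NCst 0) (NCst 0))).

(* Array 6 holds the inverse step size 72 K^2 (L + 1) (1 + 1 / eps), where
   K = 1 + n * sum (1 + J i j ^+ 2). *)
Definition rate_cmd : cmd :=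
  CReal 6 (NCst 0) (NCst 0)
    (RMul (RMul (RNat (NCst 72)) (RMul bound_rexp bound_rexp))
      (RMul (RNat (NAdd (NVar 3) (NCst 1)))
        (RAdd (RNat (NCst 1))
          (RDiv (RNat (NCst 1)) (RGet 1 (NCst 0) (NCst 1)))))).

(** For [l = - J u], moving [u] to [u + (x - u) / X] changes [l] into [l - l / X - J x / X]. The
    update is done in place, since a new entry depends only on the old entry of the same index and
    on the sample in array 3. *)
Definition update_cmd : cmd :=
  cfor 1 (CSeq
    (CReal 2 (NCst 0) (NVar 1)
      (RSub (RGet 2 (NCst 0) (NVar 1))
        (RDiv (RGet 2 (NCst 0) (NVar 1)) (RGet 6 (NCst 0) (NCst 0)))))
    (cfor 2 (CReal 2 (NCst 0) (NVar 1)
      (RSub (RGet 2 (NCst 0) (NVar 1))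
        (RDiv (RMul (RGet 0 (NVar 1) (NVar 2)) (RGet 3 (NCst 0) (NVar 2)))
              (RGet 6 (NCst 0) (NCst 0))))))).

(** The loop stops once the counter reaches the square of the inverse step size, so the number of
    iterations is this square rounded up. *)
Definition descent_guard : bexp :=
  BNot (BLeR (RMul (RGet 6 (NCst 0) (NCst 0)) (RGet 6 (NCst 0) (NCst 0)))
             (RNat (NVar 4))).

Definition descent_body : cmd :=
  CSeq (CSample 2 3) (CSeq update_cmd (CNat 4 (NAdd (NVar 4) (NCst 1)))).

Definition descent_prog : cmd :=
  CSeq sum_cmd (CSeq log_cmd (CSeq rate_cmd (CWhile descent_guard
    descent_body))).

(** * Frame conditions and correctness of the deterministic subroutines *)

Section frame.
Context {R : realType}.
Implicit Types (V A : seq nat) (s : @state R).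

Definition frame V A s s' : Prop :=
  (forall x, x \notin V -> nmem s' x = nmem s x) /\
  (forall a i j, a \notin A -> rmem s' a i j = rmem s a i j).

Lemma frame_refl V A s : frame V A s s.
Proof. by []. Qed.

Lemma frame_trans V1 V2 V A1 A2 A s s1 s2 :
  {subset V1 <= V} -> {subset V2 <= V} -> {subset A1 <= A} -> {subset A2 <= A}
    ->
  frame V1 A1 s s1 -> frame V2 A2 s1 s2 -> frame V A s s2.
Proof.
move=> sV1 sV2 sA1 sA2 [f1 g1] [f2 g2]; split=> [x xV|a i j aA].
  rewrite f2 ?f1//; [apply: contra xV; exact: sV1|apply: contra xV; exact: sV2].
rewrite g2 ?g1//; [apply: contra aA; exact: sA1|apply: contra aA; exact: sA2].
Qed.

Lemma frame_set_nat V A s s' x v : x \in V -> frame V A s s' ->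
  frame V A s (set_nat s' x v).
Proof.
move=> xV [f g]; split=> [y yV|//] /=; case: eqP => [yx|_]; last exact: f.
by rewrite yx xV in yV.
Qed.

Lemma frame_set_real V A s s' a i j v : a \in A -> frame V A s s' ->
  frame V A s (set_real s' a i j v).
Proof.
move=> aA [f g]; split=> [//|b k l bA] /=; case: eqP => [ba|_]; last exact: g.
by rewrite ba aA in bA.
Qed.

Lemma frame_answer V A n s s' b (x : 'rV[R]_n) : b \in A -> frame V A s s' ->
  frame V A s (answer s' b x).
Proof.
move=> bA [f g]; split=> [//|a k l aA] /=; case: eqP => [ab|_]; last exact: g.
by rewrite ab bA in aA.
Qed.

End frame.

Section program.
Context {R : realType} {n : nat}.
Variable D : 'rV[R]_n -> probability 'rV[R]_n R.
Implicit Types s : @state R.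

Lemma reaches_sum s : nmem s 0 = n -> rmem s 4 0 0 = 0 ->
  reaches D sum_cmd s (n * (n * 4 + 3).+3 + 3)
    (fun s' => frame [:: 1; 2]%N [:: 4]%N s s' /\ rmem s' 4 0 0 =
      \sum_(0 <= a < n) \sum_(0 <= b < n) (1 + rmem s 0 a b ^+ 2)).
Proof.
move=> s0n s40.
apply: (@reaches_for _ _ _ n 1 _ _ (fun a s' =>
    frame [:: 1; 2]%N [:: 4]%N s s' /\ rmem s' 4 0 0 =
    \sum_(0 <= a' < a) \sum_(0 <= b < n) (1 + rmem s 0 a' b ^+ 2))).
- by move=> a s' [fr1 _]; rewrite fr1.1.
- by move=> a s' v [fr h]; split => //; exact: frame_set_nat.
- move=> a s1 an [fr1 h1] s1a.
  set S0 := \sum_(0 <= a' < a) _ in h1.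
  apply: (@reaches_le _ _ _ _ _ (n * 1.+3 + 3) _ (fun s' =>
    [/\ frame [:: 1; 2]%N [:: 4]%N s s', nmem s' 1 = a & rmem s' 4 0 0 =
      S0 + \sum_(0 <= b < n) (1 + rmem s 0 a b ^+ 2)])) => //.
    by move=> s' [? ? ->]; split=> //; split => //; rewrite big_nat_recr.
  apply: (@reaches_for _ _ _ n 2 _ _ (fun b s' =>
    [/\ frame [:: 1; 2]%N [:: 4]%N s s', nmem s' 1 = a & rmem s' 4 0 0 =
      S0 + \sum_(0 <= b' < b) (1 + rmem s 0 a b' ^+ 2)])).
  + by move=> b s' [fr2 _ _]; rewrite fr2.1.
  + by move=> b s' v [fr ? ?]; split => //; exact: frame_set_nat.
  + move=> b s2 bn [fr2 s2a h2] s2b; apply: reaches_real; split=> //;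
    split => //.
      exact: frame_set_real.
    rewrite /= h2 s2a s2b big_nat_recr//= [RHS]addrA; congr (_ + (_ + _)).
    by rewrite fr2.2// expr2.
  + by split => //; rewrite big_geq// addr0.
- by split=> //; rewrite big_geq.
Qed.

Lemma reaches_log s (delta : R) L : rmem s 1 0 2 = delta -> nmem s 3 = 0%N ->
  1 <= 2 ^+ L * delta -> (forall l, (l < L)%N -> 2 ^+ l * delta < 1) ->
  reaches D log_cmd s (L * 4 + 3)
    (fun s' => frame [:: 3]%N [:: 5]%N s s' /\ nmem s' 3 = L).
Proof.
move=> sd s3 hL hl.
pose I m s' := [/\ frame [:: 3]%N [:: 5]%N s s', (m <= L)%N,
  nmem s' 3 = (L - m)%N & rmem s' 5 0 0 = 2 ^+ (L - m) * delta].
apply: (@reaches_le _ _ _ _ _ (1 + (L * 4).+1).+1 _ (I 0%N)); first by lia.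
  by move=> s' [fr _ h _]; split => //; rewrite h subn0.
apply: (reaches_seq (Q1 := I L)).
  apply: reaches_real; split=> //=; first exact: frame_set_real.
    by rewrite subnn s3.
  by rewrite subnn expr0 mul1r.
apply: reaches_while => [s' [_ _ _ h]|m s' [fr mL h3 h5]].
  by rewrite /= h subn0 negbK.
split.
  by rewrite /= h5 -ltNge; apply: hl; lia.
have E : (L - m)%N = (L - m.+1).+1 by lia.
apply: (@reaches_seq _ _ _ _ _ _ 1 1 (fun s2 =>
    [/\ frame [:: 3]%N [:: 5]%N s s2, nmem s2 3 = (L - m.+1)%N &
      rmem s2 5 0 0 = 2 ^+ (L - m) * delta])).
  apply: reaches_real; split => //=; first exact: frame_set_real.
  by rewrite h5 E exprS; ring.
move=> s2 [fr2 s23 s25]; apply: reaches_nat; split => //=.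
- exact: frame_set_nat.
- by lia.
- by rewrite s23 E addn1.
Qed.

Lemma reaches_update s (X : R) : nmem s 0 = n -> rmem s 6 0 0 = X ->
  reaches D update_cmd s (n * (n * 4 + 5).+3 + 3)
    (fun s' => frame [:: 1; 2]%N [:: 2]%N s s' /\
      forall k, (k < n)%N -> rmem s' 2 0 k = rmem s 2 0 k - rmem s 2 0 k / X -
        \sum_(0 <= b < n) rmem s 0 k b * rmem s 3 0 b / X).
Proof.
move=> s0n s6.
(* The value of entry [k] after the division and [m] terms of the inner sum. *)
pose new k m := rmem s 2 0 k - rmem s 2 0 k / X -
  \sum_(0 <= b < m) rmem s 0 k b * rmem s 3 0 b / X.
pose fr := frame [:: 1; 2]%N [:: 2]%N s.
apply: (@reaches_le _ _ _ _ _ (n * (n * 4 + 5).+3 + 3) _ (fun s' => fr s' /\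
    forall k, rmem s' 2 0 k = if (k < n)%N then new k n else rmem s 2 0 k)) =>
      //.
  by move=> s' [? h]; split => // k kn; rewrite h kn.
apply: (@reaches_for _ _ _ n 1 _ _ (fun a s' => fr s' /\
    forall k, rmem s' 2 0 k = if (k < a)%N then new k n else rmem s 2 0 k)).
- by move=> a s' [fr1 _]; rewrite fr1.1.
- by move=> a s' v [? h]; split => //; exact: frame_set_nat.
- move=> a s1 an [fr1 h1] s1a.
  (* Entries before [a] are final, entry [a] has received [b] terms, and later entries are
     untouched. *)
  pose I b s' := [/\ fr s', nmem s' 1 = a & forall k, rmem s' 2 0 k =
    if (k < a)%N then new k n else if k == a then new k b else rmem s 2 0 k].
  apply: (@reaches_le _ _ _ _ _ (1 + (n * 1.+3 + 3)).+1 _ (I n)); first by lia.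
    move=> s' [? ? h]; split=> //; split => // k; rewrite h ltnS.
    by case: (ltngtP k a).
  apply: (reaches_seq (Q1 := I 0%N)).
    apply: reaches_real; split => //; first exact: frame_set_real.
    move=> k /=; rewrite s1a; have [->|ka] := eqVneq k a; rewrite /= h1.
      by rewrite ltnn fr1.2// s6 /new big_geq// subr0.
    by [].
  move=> s2; apply: (@reaches_for _ _ _ n 2 _ _ I).
  + by move=> b s' [fr2 _ _]; rewrite fr2.1.
  + by move=> b s' v [? ? ?]; split => //; exact: frame_set_nat.
  + move=> b s3 bn [fr3 s3a h3] s3b; apply: reaches_real; split=> //;
    split => //.
      exact: frame_set_real.
    move=> k /=; rewrite s3a; have [->|ka] := eqVneq k a; rewrite /= h3.
      rewrite ltnn eqxx s3b !fr3.2// s6 /new big_nat_recr//= opprD addrA.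
      by [].
    by rewrite (negPf ka).
- by split.
Qed.

End program.

(** * The sampling loop *)

Section descent_loop.
Context {R : realType} {n : nat}.
Variables (P : probability 'rV[R]_n R) (J : 'M[R]_n).
Hypotheses (P_box : P box = 1%E).
Variables (post : @state R -> Prop) (V : nat -> 'rV[R]_n -> R).
Variables (T : nat) (X : R) (s1 : @state R).
Hypotheses (X1 : 1 <= X) (XT : X * X <= T%:R).
Hypothesis XT_min : forall c, (c < T)%N -> c%:R < X * X.
Hypotheses (s1n : nmem s1 0 = n) (s1X : rmem s1 6 0 0 = X).
Hypothesis s1J : forall i j : 'I_n, rmem s1 0 i j = J i j.
Hypothesis V0 : forall s u, box u -> output n s = mfield J u ->
  V 0 u <= `[< post s >]%:R.
Hypothesis VS : forall k u, box u -> exists w, forall x, box x ->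
  V k.+1 u - dot w (x - tmean P J u) <= V k (u + X^-1 *: (x - u)).

(** Backward induction: [V k u] bounds from below the success probability from [u] with [k]
    iterations left. [VS] expresses that [V] does not decrease on average along a step, with an
    affine minorant in place of an expectation. The point [u] is a ghost variable: the memory only
    holds [- J u]. *)
Lemma success_ge_descent k s u : (k <= T)%N ->
  frame [:: 1; 2; 4]%N [:: 2; 3]%N s1 s -> nmem s 4 = (T - k)%N ->
  box u -> get_row n s 2 = mfield J u ->
  success_ge (tilt P) post (V k u) (k * (n * (n * 4 + 5).+3 + 8)).+1
    [:: CWhile descent_guard descent_body] s.
Proof.
elim: k s u => [|k IH] s u kT fr s4 ub su.
  apply: success_ge_whileF; last exact/success_ge_nil/V0.
  by rewrite /= fr.2// s1X s4 subn0 negbK.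
(* The three outer steps are the guard, the sequencing and the oracle call. *)
have -> : (k.+1 * (n * (n * 4 + 5).+3 + 8)).+1 =
  ((n * (n * 4 + 5).+3 + 3 + 1).+1 +
    (k * (n * (n * 4 + 5).+3 + 8)).+1).+3 by rewrite mulSn; lia.
apply: success_ge_whileT.
  by rewrite /= fr.2// s1X s4 -ltNge XT_min//; lia.
apply: success_ge_seq.
have [w hw] := VS k ub.
apply: (success_ge_sample (w := w)); first exact: tilt_box.
move=> x xb; set s2 := answer s 3 x.
have fr2 : frame [:: 1; 2; 4]%N [:: 2; 3]%N s1 s2 by exact: frame_answer.
have s2n : nmem s2 0 = n by rewrite fr2.1.
have s2X : rmem s2 6 0 0 = X by rewrite fr2.2.
have H := reaches_update (tilt P) s2n s2X.
apply: (@success_ge_reaches _ _ _ _ _ _ _ _ _ _ (fun s' => [/\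
    frame [:: 1; 2; 4]%N [:: 2; 3]%N s1 s', nmem s' 4 = (T - k)%N &
    get_row n s' 2 = mfield J (u + X^-1 *: (x - u))])).
  apply: (reaches_seq H) => s3 [fr3 h3]; apply: reaches_nat.
  have fr4 : frame [:: 1; 2; 4]%N [:: 2; 3]%N s1 s3.
    by apply: frame_trans fr2 fr3 => // y; rewrite !inE; lia.
  split; first exact: frame_set_nat.
    by rewrite /= fr3.1//= s4; lia.
  apply/rowP => i; rewrite mxE /= h3//.
  have uE (j : 'I_n) : rmem s 2 0 j = mfield J u ord0 j by rewrite -su mxE.
  rewrite [rmem s2 2 0 i]uE big_mkord.
  have -> : \sum_(b < n) rmem s2 0 i b * rmem s2 3 0 b / X =
      mulv J x ord0 i / X.
    rewrite mulvE mulr_suml; apply: eq_bigr => b _.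
    by rewrite fr2.2// s1J /= valK.
  rewrite /mfield mulvD mulvZ mulvB !mxE.
  by rewrite mulrBr mulNr opprK opprD opprB addrA addrAC; ring.
move=> s' [fr' s'4 s'2] t' tt'.
apply: le_trans (IH s' _ _ fr' s'4 _ s'2 t' tt'); last 2 first.
- lia.
- apply: box_convex => //; rewrite invr_ge0 (le_trans ler01 X1)/=.
  by rewrite invf_le1// (lt_le_trans ltr01 X1).
have := hw x xb; rewrite lee_fin; apply: le_trans.
by rewrite /tmean -su.
Qed.

End descent_loop.

(** * The exponential potential *)

Section potential.
Context {R : realType} {n : nat}.
Variables (P : probability 'rV[R]_n R) (J : 'M[R]_n) (M eps K X : R) (L : nat).
Hypotheses (P_box : P box = 1%E) (psdJ : psd J).
Hypothesis cov_le : forall l, opnorm (covmx (tilt P l)) <= M.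
Hypotheses (K1 : 1 <= K) (KJ : n%:R * \sum_i \sum_j (1 + J i j ^+ 2) <= K).
Hypotheses (eps0 : 0 < eps) (X1 : 1 <= X) (XK : 12 * K <= X).
Hypotheses (XL : 24 * K * L.+1%:R <= eps * X) (XK2 : 72 * K ^+ 2 <= eps * X).

Definition gap u : R :=
  free_energy P J u - (ln (partfun P (negquad J)) + M * \tr J / 2).
(** Chosen so that [theta * (eps / 2)] is [L.+1], which makes the final failure probability at most
    [expR (- L.+1%:R)]. *)
Definition theta : R := 2 * L.+1%:R / eps.
(** The second order errors [18 * X^-1 ^+ 2 * K ^+ 2] of [k] steps, summed as a geometric series of
    ratio [1 - X^-1]. *)
Definition noise k : R := 18 * X^-1 * K ^+ 2 * (1 - (1 - X^-1) ^+ k).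
(** One minus the Chernoff bound on the probability that the gap exceeds [eps] after [k] further
    steps. *)
Definition potential k u : R :=
  1 - expR (theta * ((1 - X^-1) ^+ k * gap u + noise k - eps)).

Let X0 : 0 < X. Proof. exact: lt_le_trans ltr01 X1. Qed.
Let eta0 : 0 <= X^-1. Proof. by rewrite invr_ge0 ltW. Qed.
Let eta1 : X^-1 <= 1. Proof. by rewrite invf_le1. Qed.
Let rho0 k : 0 <= (1 - X^-1) ^+ k. Proof. by rewrite exprn_ge0// subr_ge0. Qed.
Let rho1 k : (1 - X^-1) ^+ k <= 1.
Proof. by rewrite exprn_ile1// ?subr_ge0// gerBl. Qed.
Let theta0 : 0 <= theta. Proof. by rewrite divr_ge0// ltW. Qed.

Lemma gap_le u : 2 * gap u <= quad J (u - tmean P J u).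
Proof. by rewrite /gap opprD addrA; apply: free_energy_gap. Qed.

(** The weight [(1 - X^-1) ^+ k] on the gap takes up the contraction of one step. Hence
    [exp_free_energy_step] is applied with parameter [theta * rho], which is at most [theta], so the
    smallness condition is checked for [theta] alone. *)
Lemma potential_step k u : box u -> exists w, forall x, box x ->
  potential k.+1 u - dot w (x - tmean P J u) <=
  potential k (u + X^-1 *: (x - u)).
Proof.
move=> ub; set rho := (1 - X^-1) ^+ k.
have e1 : 4 * X^-1 * K <= 3^-1.
  by rewrite mulrAC ler_pdivrMr//; move: XK; lra.
have e2 : 0 <= theta * rho by rewrite mulr_ge0// rho0.
have e3 : 12 * (theta * rho * X^-1) * K <= 1.
  apply: (@le_trans _ _ (12 * (theta * X^-1) * K)).
    rewrite ler_wpM2r ?(le_trans ler01 K1)// ler_wpM2l// ler_wpM2r//.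
    by rewrite ler_piMr// rho1.
  have -> : 12 * (theta * X^-1) * K = (24 * K * L.+1%:R) / (eps * X).
    by rewrite /theta; field; rewrite !gt_eqF.
  by rewrite ler_pdivrMr ?mulr_gt0// mul1r.
have [w hw] : exists w, forall x, box x ->
    expR (theta * rho * gap (u + X^-1 *: (x - u))) <=
    expR (theta * rho * ((1 - X^-1) * gap u + 18 * X^-1 ^+ 2 * K ^+ 2)) +
    dot w (x - tmean P J u).
  exact: (exp_free_energy_step P_box psdJ K1 KJ eta0 e1 e2 e3 ub (gap_le u)).
pose B0 := expR (theta * (noise k - eps)).
exists (B0 *: w) => x xb; have := hw x xb.
rewrite dotZl => h.
rewrite /potential -addrA lerD2l -opprD lerN2.
set u' := u + _; rewrite -/rho.
have -> : theta * (rho * gap u' + noise k - eps) =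
  theta * (noise k - eps) + theta * rho * gap u' by ring.
have -> : theta * ((1 - X^-1) ^+ k.+1 * gap u + noise k.+1 - eps) =
    theta * (noise k - eps) +
    theta * rho * ((1 - X^-1) * gap u + 18 * X^-1 ^+ 2 * K ^+ 2).
  by rewrite /noise exprS -/rho; ring.
by rewrite !expRD -/B0 -mulrDr ler_pM2l ?expR_gt0.
Qed.

(** The pointwise form of Markov's inequality: the potential is at most 1 always, and nonpositive
    when the gap exceeds [eps]. *)
Lemma potential0_le u (Q : Prop) : (gap u <= eps -> Q) ->
  potential 0 u <= `[< Q >]%:R.
Proof.
rewrite /potential => h; have [ge|lt] := leP (gap u) eps.
  by rewrite asboolT; [rewrite gerBl expR_ge0|exact: h].
apply: le_trans (ler0n _ _); rewrite subr_le0 expr0 mul1r /noise expr0 subrr.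
rewrite mulr0 addr0 -[leLHS](expR0 R) ler_expR mulr_ge0// subr_ge0.
exact: ltW.
Qed.

Lemma potential_start T (delta : R) : X * X <= T%:R -> 1 <= 2 ^+ L * delta ->
  1 - delta <= potential T 0.
Proof.
move=> XT Ld; rewrite /potential lerD2l lerN2; set rho := (1 - X^-1) ^+ T.
(* The gap inequality itself bounds the initial value, since 0 and the mean of the tilt lie in the
   cube. *)
have gap0 : gap 0 <= 2 * K.
  have h := gap_le 0; have mb := tmean_box J P_box 0.
  have h2 := le_trans (ler_norm _) (box_form_le KJ box0 mb box0 mb).
  by have := le_trans h h2; lra.
(* With at least [X * X] iterations, [rho <= expR (- X) <= X^-1]. *)
have rhoX : rho <= X^-1.
  have h : 1 - X^-1 <= expR (- X^-1) by exact: expR_ge1Dx.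
  apply: (@le_trans _ _ (expR (- X^-1) ^+ T)).
    by apply: lerXn2r => //; rewrite nnegrE ?expR_ge0 ?subr_ge0.
  rewrite -expRM_natl mulrN expRN lef_pV2 ?posrE ?expR_gt0//.
  apply: (@le_trans _ _ (expR X)).
    by apply: le_trans (expR_ge1Dx X); rewrite lerDr.
  by rewrite ler_expR ler_pdivlMr.
have n1 : noise T <= eps / 4.
  rewrite /noise; apply: (@le_trans _ _ (18 * X^-1 * K ^+ 2)).
    apply: ler_piMr; last by rewrite gerBl rho0.
    by apply: mulr_ge0; [exact: mulr_ge0|exact: sqr_ge0].
  rewrite mulrAC ler_pdivrMr//; move: XK2; lra.
have r1 : rho * gap 0 <= eps / 4.
  apply: (@le_trans _ _ (X^-1 * (2 * K))).
    apply: (@le_trans _ _ (rho * (2 * K))); first by rewrite ler_wpM2l// rho0.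
    by rewrite ler_wpM2r// mulr_ge0// (le_trans ler01 K1).
  rewrite mulrC ler_pdivrMr//.
  have : K <= K ^+ 2 by rewrite expr2 ler_peMr// (le_trans ler01 K1).
  have := K1; move: XK2; lra.
(* Initial gap and noise use a quarter of [eps] each, which leaves [- eps / 2] in the exponent. *)
apply: (@le_trans _ _ (expR (- L.+1%:R))).
  rewrite ler_expR -/rho.
  have -> : - L.+1%:R = theta * (- (eps / 2)).
    by rewrite /theta; field; rewrite gt_eqF.
  rewrite ler_wpM2l//; move: n1 r1; lra.
rewrite expRN -[leLHS]mul1r ler_pdivrMr ?expR_gt0//.
have d0 : 0 <= delta.
  rewrite -(@pmulr_rge0 _ (2 ^+ L)) ?exprn_gt0//; exact: le_trans Ld.
apply: le_trans Ld _; rewrite mulrC ler_wpM2l// -[L.+1%:R]mulr1 expRM_natl.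
apply: (@le_trans _ _ (2 ^+ L.+1)); first by rewrite ler_eXn2l// ltr1n.
by rewrite ler_pXn2r ?nnegrE ?expR_ge0// (le_trans _ (expR_ge1Dx 1))// -natr1.
Qed.

End potential.

(** * Support in the cube, choice of parameters and running time *)

Lemma sphere_box (R : realType) (n : nat) (P : probability 'rV[R]_n R) :
  P [set x | enorm x = Num.sqrt n%:R] = 1%E -> P box = 1%E.
Proof.
move=> P1; apply/eqP; rewrite eq_le probability_le1//=.
rewrite -[leLHS]P1; apply: le_measure; rewrite ?inE//; last first.
  exact: sphere_sub_box.
(* The sphere is a level set of the identity form, hence measurable. *)
have -> : [set x : 'rV[R]_n | enorm x = Num.sqrt n%:R] =
    quad 1%:M @^-1` [set n%:R].
  apply/seteqP; split=> x; rewrite /= /quad /mulv trmx1 mulmx1.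
    by move=> /eqP; rewrite eqr_sqrt ?dot_ge0// => /eqP.
  by rewrite /enorm => ->.
rewrite -[X in measurable X]setTI; exact: measurable_quad.
Qed.

Section parameters.
Context {R : realType}.

Definition entry_sum n (J : 'M[R]_n) : R := \sum_i \sum_j (1 + J i j ^+ 2).
Definition form_bound n (J : 'M[R]_n) : R := 1 + n%:R * entry_sum J.
Definition rate n (J : 'M[R]_n) (eps : R) (L : nat) : R :=
  72 * (form_bound J * form_bound J) * (L.+1%:R * (1 + eps^-1)).

Lemma form_bound_ge1 n (J : 'M[R]_n) : 1 <= form_bound J.
Proof.
rewrite lerDl mulr_ge0// sumr_ge0// => i _; rewrite sumr_ge0// => j _.
by rewrite addr_ge0// sqr_ge0.
Qed.

Lemma form_bound_ge n (J : 'M[R]_n) :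
  n%:R * \sum_i \sum_j (1 + J i j ^+ 2) <= form_bound J.
Proof. by rewrite lerDr. Qed.

(** The factor [1 + e^-1] makes both [X] and [e * X] at least a multiple of [K * K], whether [e] is
    small or large. *)
Lemma rate_bounds (K e : R) (l : R) : 1 <= K -> 0 < e -> 1 <= l ->
  let X := 72 * (K * K) * (l * (1 + e^-1)) in
  [/\ 1 <= X, 12 * K <= X, 24 * K * l <= e * X & 72 * K ^+ 2 <= e * X].
Proof.
move=> K1 e0 l1 X.
have ei : 0 < e^-1 by rewrite invr_gt0.
have KK : K <= K * K by nra.
have lei : 1 <= l * (1 + e^-1) by nra.
have X72 : 72 * (K * K) <= X by rewrite /X ler_peMr// mulr_ge0//; nra.
have eX : 72 * (K * K) * l <= e * X.
  have -> : e * X = 72 * (K * K) * l * (e + 1).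
    by rewrite /X; field; rewrite gt_eqF.
  by rewrite ler_peMr ?lerDr ?ltW//; nra.
by rewrite expr2; split; nra.
Qed.

Lemma exists_log (delta : R) : 0 < delta -> exists L, 1 <= 2 ^+ L * delta.
Proof.
move=> d0; exists (Num.Def.archi_bound delta^-1).
rewrite -ler_pdivrMr// mul1r.
have di : 0 <= delta^-1 by rewrite invr_ge0 ltW.
apply: le_trans (ltW (archi_boundP di)) _.
by rewrite -natrX ler_nat ltnW// ltn_expl.
Qed.

(** Minimality of [L] gives [2 ^+ L.-1 < delta^-1] for positive [L], and [expR 2^-1 <= 2] turns this
    into a bound by the natural logarithm. *)
Lemma log_le (delta : R) L : 0 < delta < 1 ->
  (forall l, (l < L)%N -> 2 ^+ l * delta < 1) ->
  L.+1%:R <= 2 * (1 + ln delta^-1).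
Proof.
move=> /andP[d0 d1] hL.
have ln0 : 0 <= ln delta^-1 by rewrite ln_ge0// invf_ge1// ltW.
case: L hL => [_|l hL]; first by lra.
have e2 : expR 2^-1 <= 2 :> R.
  rewrite -[leLHS]invrK -expRN -[leRHS]invrK lef_pV2 ?posrE ?invr_gt0
    ?expR_gt0//.
  by apply: le_trans (expR_ge1Dx _); lra.
have h : expR (l%:R * 2^-1) <= delta^-1.
  rewrite expRM_natl; apply: (@le_trans _ _ (2 ^+ l)).
    by apply: lerXn2r => //; rewrite nnegrE ?expR_ge0.
  by rewrite -[leRHS]mul1r ler_pdivlMr// ltW// hL.
have : l%:R * 2^-1 <= ln delta^-1.
  by rewrite -[leLHS]expRK ler_ln ?posrE ?expR_gt0 ?invr_gt0.
by rewrite -(natr1 l.+1) -(natr1 l); lra.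
Qed.

(** Entries are at most the operator norm, so each of the [n * n] summands is at most [B ^+ 2]. The
    outer factor [n] and the added 1 account for the fifth power. *)
Lemma form_bound_le n (J : 'M[R]_n) (B : R) :
  1 + n%:R <= B -> 1 + opnorm J <= B -> form_bound J <= B ^+ 5.
Proof.
move=> nB JB; have oJ := opnorm_ge0 J.
have B1 : 1 <= B by apply: le_trans nB; rewrite lerDl.
have hS : entry_sum J <= n%:R * n%:R * B ^+ 2.
  have -> : n%:R * n%:R * B ^+ 2 = \sum_(i < n) \sum_(j < n) B ^+ 2.
    by rewrite !sumr_const !card_ord -mulrnA -[RHS]mulr_natl natrM.
  apply: ler_sum => i _; apply: ler_sum => j _.
  have := entry_le_opnorm J i j; rewrite ler_norml => /andP[h1 h2]; nra.
rewrite /form_bound; have n0 : 0 <= n%:R :> R by [].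
apply: (@le_trans _ _ (1 + n%:R * (B * B * B ^+ 2))).
  rewrite lerD2l ler_wpM2l//; apply: le_trans hS _.
  by rewrite ler_wpM2r ?sqr_ge0//; nra.
have -> : B * B * B ^+ 2 = B ^+ 4 by ring.
have : 1 <= B ^+ 4 by rewrite exprn_ege1.
rewrite [B ^+ 5]exprS; set b := B ^+ 4; nra.
Qed.

Lemma rate_le n (J : 'M[R]_n) (eps B : R) L : 0 < eps ->
  1 + n%:R <= B -> 1 + opnorm J <= B -> 1 + eps^-1 <= B -> L.+1%:R <= 2 * B ->
  rate J eps L <= 144 * B ^+ 12.
Proof.
move=> e0 nB JB eB LB; have K1 := form_bound_ge1 J.
have hK := form_bound_le nB JB; rewrite /rate; set K := form_bound J in K1 hK *.
have K0 : 0 <= K by exact: le_trans K1.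
have ei : 0 <= 1 + eps^-1 by rewrite addr_ge0// invr_ge0 ltW.
have -> : 144 * B ^+ 12 = 72 * (B ^+ 5 * B ^+ 5) * (2 * B * B) by ring.
by rewrite !ler_pM ?mulr_ge0.
Qed.

End parameters.

Definition prog_time (n L T : nat) : nat :=
  (n * (n * 4 + 3).+3 + 3 + (L * 4 + 3 +
    (1 + (T * (n * (n * 4 + 5).+3 + 8)).+1).+1).+1).+1.

Lemma prog_time_le n L T : (prog_time n L T <=
  100 * ((n.+1 * n.+1) * (T.+1 * L.+1)))%N.
Proof. by rewrite /prog_time; nia. Qed.

(** * The complete program and the theorem *)

Section prog.
Context {R : realType} {n : nat}.
Variables (P : probability 'rV[R]_n R) (J : 'M[R]_n) (M eps delta : R).
Hypothesis P_box : P box = 1%E.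
Variables (post : @state R -> Prop) (V : nat -> 'rV[R]_n -> R) (L T : nat).
Let X := rate J eps L.
Hypotheses (X1 : 1 <= X) (XT : X * X <= T%:R).
Hypothesis XT_min : forall c, (c < T)%N -> c%:R < X * X.
Hypotheses (hL : 1 <= 2 ^+ L * delta).
Hypothesis hL_min : forall l, (l < L)%N -> 2 ^+ l * delta < 1.
Hypothesis V0 : forall s u, box u -> output n s = mfield J u ->
  V 0 u <= `[< post s >]%:R.
Hypothesis VS : forall k u, box u -> exists w, forall x, box x ->
  V k.+1 u - dot w (x - tmean P J u) <= V k (u + X^-1 *: (x - u)).

Lemma success_ge_prog : success_ge (tilt P) post (V T 0) (prog_time n L T)
  [:: descent_prog] (input J M eps delta).
Proof.
set s0 := input _ _ _ _; apply: success_ge_seq.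
apply: (success_ge_reaches (reaches_sum (tilt P) (s := s0) _ _)) => //.
move=> s1 [fr1 h1].
have {}h1 : rmem s1 4 0 0 = entry_sum J.
  rewrite h1 big_mkord; apply: eq_bigr => i _; rewrite big_mkord.
  by apply: eq_bigr => j _; rewrite /= !valK.
apply: success_ge_seq.
apply: (success_ge_reaches (reaches_log (tilt P) (s := s1) _ _ hL hL_min)).
- by rewrite fr1.2.
- by rewrite fr1.1.
move=> s2 [fr2 h2]; apply: success_ge_seq.
have fr3 : frame [:: 1; 2; 3]%N [:: 4; 5]%N s0 s2.
  by apply: frame_trans fr1 fr2 => // y; rewrite !inE; lia.
apply: (@success_ge_reaches _ _ _ _ _ _ _ _ _ _ (fun s3 =>
    frame [:: 1; 2; 3]%N [:: 4; 5; 6]%N s0 s3 /\ rmem s3 6 0 0 = X)).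
  apply: reaches_real; split.
    apply: frame_set_real => //.
    by apply: frame_trans (frame_refl [::] [::] s0) fr3 => // y; rewrite !inE;
      lia.
  rewrite /= h2 fr2.2// h1 fr3.1// fr3.2//= addn1 /X /rate /form_bound.
  by rewrite mul1r.
move=> s3 [fr h6].
apply: (@success_ge_descent _ _ P J P_box post V T X s3) => //.
- by rewrite fr.1.
- by move=> i j; rewrite fr.2//= !valK.
- by rewrite fr.1//= subnn.
- exact: box0.
(* The zero-initialized output array represents the starting point [u = 0]. *)
- rewrite /mfield mulv0 oppr0; apply/rowP => i.
  by rewrite !mxE fr.2.
Qed.

End prog.

Theorem theoremB1 (R : realType) :
  exists (prog : cmd) (C k : nat),
  forall (n : nat) (P : probability 'rV[R]_n R) (M : R) (J : 'M[R]_n)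
    (eps delta : R),
  P [set x | enorm x = Num.sqrt n%:R] = 1%E ->
  (forall l : 'rV[R]_n, opnorm (covmx (tilt P l)) <= M) ->
  psd J ->
  0 < eps ->
  0 < delta < 1 ->
  exists t : nat,
  [/\ t%:R <= C%:R * (1 + n%:R + eps^-1 + M + ln delta^-1 + opnorm J) ^+ k,
      run (tilt P) t (fun s => (ncalls s <= t)%N) [:: prog]
        (input J M eps delta) = 1%E
    & ((1 - delta)%:E <=
       run (tilt P) t
         (fun s => forall x, msupport P x ->
            (ln (dreweighted_dtilt P J (output n s) x) <= M * \tr J + eps)%R)
         [:: prog] (input J M eps delta))%E].
Proof.
(* In the degree 27, [n.+1 * n.+1] contributes 2, [T.+1] contributes 24 as [X * X] with [X] of
   degree 12, and [L.+1] contributes 1. The constant collects 100 from [prog_time_le], 3 and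
   [144 * 144] from [T.+1], and 2 from [L.+1]. *)
exists descent_prog, (600 * (144 * 144))%N, 27%N.
move=> n P M J eps delta /sphere_box P_box cov_le psdJ eps0 d01.
have /andP[d0 d1] := d01.
have M0 : 0 <= M by apply: le_trans (cov_le 0); exact: opnorm_ge0.
have tr0 : 0 <= \tr J by apply: sumr_ge0 => i _; exact: psd_diag_ge0.
have [L hL hL_min'] := ex_minnP (exists_log d0).
have hL_min l : (l < L)%N -> 2 ^+ l * delta < 1.
  by move=> lL; rewrite ltNge; apply/negP => /hL_min'; rewrite leqNgt lL.
pose K := form_bound J; pose X := rate J eps L.
have [X1 XK XL XK2] : [/\ 1 <= X, 12 * K <= X, 24 * K * L.+1%:R <= eps * X &
    72 * K ^+ 2 <= eps * X].
  by apply: rate_bounds => //; [exact: form_bound_ge1|rewrite ler1n].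
have exT : exists T : nat, X * X <= T%:R.
  exists (Num.Def.archi_bound (X * X)); apply/ltW/archi_boundP.
  by rewrite mulr_ge0// (le_trans ler01 X1).
have [T XT XT_min'] := ex_minnP exT.
have XT_min c : (c < T)%N -> c%:R < X * X.
  by move=> cT; rewrite ltNge; apply/negP => /XT_min'; rewrite leqNgt cT.
exists (prog_time n L T); split.
- set B := 1 + n%:R + _ + _ + _ + _.
  have ei : 0 <= eps^-1 by rewrite invr_ge0 ltW.
  have ln0 : 0 <= ln delta^-1 by rewrite ln_ge0// invf_ge1// ltW.
  have oJ := opnorm_ge0 J; have n0 : 0 <= n%:R :> R by [].
  have B1 : 1 + n%:R <= B by rewrite /B; lra.
  have B2 : 1 + opnorm J <= B by rewrite /B; lra.
  have B3 : 1 + eps^-1 <= B by rewrite /B; lra.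
  have B4 : 1 + ln delta^-1 <= B by rewrite /B; lra.
  have LB : L.+1%:R <= 2 * B.
    by apply: le_trans (log_le d01 hL_min) _; rewrite ler_pM2l.
  have XB := rate_le eps0 B1 B2 B3 LB; rewrite -/X in XB.
  have X0 : 0 <= X by exact: le_trans X1.
  have XX1 : 1 <= X * X by rewrite mulr_ege1.
  (* Minimality of [T] gives [T.+1 <= X * X + 2], and [X * X] is at least 1. *)
  have TX : T.+1%:R <= 3 * (X * X).
    case: (T) XT_min => [_|T' h]; first by lra.
    by have := h T' (ltnSn _); rewrite -(natr1 T'.+1) -(natr1 T'); lra.
  have TB : T.+1%:R <= 3 * (144 * B ^+ 12 * (144 * B ^+ 12)).
    by apply: le_trans TX _; rewrite ler_pM2l// ler_pM.
  apply: (@le_trans _ _ (100 * ((n.+1%:R * n.+1%:R) * (T.+1%:R * L.+1%:R)))).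
    by rewrite -!natrM ler_nat prog_time_le.
  have -> : (600 * (144 * 144))%N%:R * B ^+ 27 = 100 * ((B * B) *
      (3 * (144 * B ^+ 12 * (144 * B ^+ 12)) * (2 * B))).
    by rewrite !natrM; ring.
  have nB : n.+1%:R <= B by rewrite -(natr1 n) addrC.
  by rewrite ler_pM2l//; apply: ler_pM; rewrite ?mulr_ge0//; exact: ler_pM.
- rewrite run_ncalls//; apply/eqP; rewrite eq_le run_le1/=.
  suff h : success_ge (tilt P) (fun=> True) 1 (prog_time n L T)
      [:: descent_prog] (input J M eps delta) by exact: h (leqnn _).
  (* The constant value 1 shows that the program halts within its time bound with probability 1. *)
  apply: (@success_ge_prog _ _ P J M eps delta P_box _ (fun _ _ => 1) L T) =>
    //.
    by move=> s u _ _; rewrite asboolT.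
  by move=> k u _; exists 0 => x _; rewrite dot0l subr0.
- set post := (X in run _ _ X).
  apply: (@le_trans _ _ (potential P J M eps K X L T 0)%:E).
    rewrite lee_fin; apply: potential_start => //.
      exact: form_bound_ge1.
    exact: form_bound_ge.
  suff h : success_ge (tilt P) post (potential P J M eps K X L T 0)
      (prog_time n L T) [:: descent_prog] (input J M eps delta) by exact: h
        (leqnn _).
  apply: (@success_ge_prog _ _ P J M eps delta P_box _
      (potential P J M eps K X L) L T) => //.
    move=> s u ub su; apply: potential0_le => // gu x _.
    rewrite su; apply: le_trans (ln_dreweighted_dtilt_le _ _ _ _) _ => //.
    (* A gap of at most [eps] gives the bound with [M * \tr J / 2], and [M * \tr J] is
       nonnegative. *)
    have := mulr_ge0 M0 tr0; move: gu; rewrite /gap; lra.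
  move=> k u ub; apply: potential_step => //.
    exact: form_bound_ge1.
  exact: form_bound_ge.
Qed.
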